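(* Let $S\subseteq([-1,1]\cup\{*\})^X$ be a partial hypothesis class and $B\subseteq[-1,1]^X$ a total hypothesis class. Let $\ell:\{-1,1\}\times[-1,1]\to\mathbb{R}$ be a loss such that $\ell(y,\cdot)$ is convex and $\kappa$-Lipschitz for each $y\in\{-1,1\}$. For $\beta,\eta_1,\eta_2,\delta\in(0,1/2)$, letting $m:=\sup_{r:X\to\mathbb{R}}\sup_{\theta\in\mathbb{R}}\mathsf{VC}(S^{(r)}_{\eta_1},B^{(\theta)}_{\eta_2})$, \[ \#\mathsf{CompR}(S,B,\ell,\kappa(\beta+2\eta_1+4\eta_2),\delta)\le O\!\left(\frac m{\beta^6}\log_+^2\!\left(\frac m\beta\right)\log\!\left(\frac1{\eta_1}\right)+\frac1{\beta^6}\log\!\left(\frac1{\eta_1}\right)\log\!\left(\frac1{\beta\delta}\right)+\frac1{\beta^4}\log\!\left(\frac1{\eta_2}\right)\right). \]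
   Context: $X$ non-empty; distributions discrete. $h^{(r)}_\eta(x)=1$ if $h(x)\ne*$ and $h(x)>r(x)+\eta$, $=-1$ if $h(x)\ne*$ and $h(x)<r(x)-\eta$, $=*$ otherwise; $H^{(r)}_\eta=\{h^{(r)}_\eta:h\in H\}$, $H^{(\theta)}_\eta$ for constant $r\equiv\theta$. $\mathsf{VC}(H_1,H_2)$ for binary classes: sup of $|X'|$ over $X'\subseteq X$ shattered by both (every $\xi:X'\to\{\pm1\}$ agrees on $X'$ with some member). Comparative regression $\mathsf{CompR}_n(S,B,\ell,\varepsilon,\delta)$: (possibly randomized) learners taking $n$ points of $X\times\{-1,1\}$ and outputting $f:X\to[-1,1]$ such that for every distribution $\mu$ on $X\times\{-1,1\}$ for which some $s\in S$ has $\Pr_{x\sim\mu|_X}[s(x)\neq*]=1$ and $\mathbb{E}_\mu[y|x]=s(x)$, given $n$ i.i.d. samples, with probability $\ge1-\delta$, $\mathbb{E}_\mu[\ell(y,f(x))]\le\inf_{b\in B}\mathbb{E}_\mu[\ell(y,b(x))]+\varepsilon$. $\#\mathsf{CompR}$ is the least such $n$. $\log_+(u)=\log_2\max\{2,u\}$. *)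

(* Defs.v *)
From Stdlib Require Import Reals Lra List ClassicalEpsilon.
From Coquelicot Require Import Coquelicot.
Open Scope R_scope.

Definition ind (P : Prop) : R :=
  if excluded_middle_informative P then 1 else 0.

(* Partial binary hypotheses: None = star, Some true = +1, Some false = -1. *)
Definition thr {X : Type} (r : X -> R) (eta : R) (h : X -> option R)
  : X -> option bool :=
  fun x => match h x with
           | None => None
           | Some v =>
               if Rlt_dec (r x + eta) v then Some true
               else if Rlt_dec v (r x - eta) then Some false
               else None
           end.

Definition thr_class {X : Type} (H : (X -> option R) -> Prop) (r : X -> R)
  (eta : R) : (X -> option bool) -> Prop :=
  fun g => exists h, H h /\ g = thr r eta h.

Definition total_as_partial {X : Type} (B : (X -> R) -> Prop)
  : (X -> option R) -> Prop :=
  fun h => exists b, B b /\ h = (fun x => Some (b x)).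

Definition shatters {X : Type} (H : (X -> option bool) -> Prop) (xs : list X)
  : Prop :=
  forall xi : nat -> bool, exists h, H h /\
    forall i x, nth_error xs i = Some x -> h x = Some (xi i).

Definition VC2_le {X : Type} (H1 H2 : (X -> option bool) -> Prop) (d : nat)
  : Prop :=
  forall xs : list X, NoDup xs -> shatters H1 xs -> shatters H2 xs ->
    (length xs <= d)%nat.

Definition supVC_le {X : Type} (S : (X -> option R) -> Prop)
  (B : (X -> R) -> Prop) (eta1 eta2 : R) (d : nat) : Prop :=
  forall (r : X -> R) (theta : R),
    VC2_le (thr_class S r eta1)
           (thr_class (total_as_partial B) (fun _ => theta) eta2) d.

Definition is_supVC {X : Type} (S : (X -> option R) -> Prop)
  (B : (X -> R) -> Prop) (eta1 eta2 : R) (m : nat) : Prop :=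
  supVC_le S B eta1 eta2 m /\
  forall d, supVC_le S B eta1 eta2 d -> (m <= d)%nat.

(* Atoms atom i (distinct among positive-weight indices) with marginal weight
   wt i, and cp i = Pr[y = 1 | x = atom i]. *)
Record dist (X : Type) := {
  atom : nat -> X;
  wt : nat -> R;
  cp : nat -> R;
  wt_ge0 : forall i, 0 <= wt i;
  wt_sum : is_series wt 1;
  cp_01 : forall i, 0 <= cp i <= 1;
  atom_inj : forall i j, 0 < wt i -> 0 < wt j -> atom i = atom j -> i = j
}.
Arguments atom {X}. Arguments wt {X}. Arguments cp {X}.

Definition risk {X : Type} (mu : dist X) (loss : R -> R -> R) (f : X -> R) : R :=
  Series (fun i => wt mu i *
    (cp mu i * loss 1 (f (atom mu i)) + (1 - cp mu i) * loss (-1) (f (atom mu i)))).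

Fixpoint sprob {X : Type} (mu : dist X) (n : nat)
  (E : list (X * R) -> Prop) : R :=
  match n with
  | O => ind (E nil)
  | S n' => Series (fun i => wt mu i *
      (cp mu i * sprob mu n' (fun s => E ((atom mu i, 1) :: s))
       + (1 - cp mu i) * sprob mu n' (fun s => E ((atom mu i, -1) :: s))))
  end.

(* mu is realizable by some s in S: Pr[s(x) <> star] = 1 and E[y|x] = s(x) *)
Definition realizable {X : Type} (S : (X -> option R) -> Prop) (mu : dist X)
  : Prop :=
  exists s, S s /\
    forall i, 0 < wt mu i -> s (atom mu i) = Some (2 * cp mu i - 1).

(* A (possibly randomized) learner: a discrete mixture, with weights v j,
   of deterministic learners L j mapping samples to f : X -> [-1,1]. *)
Definition CompR {X : Type} (n : nat) (S : (X -> option R) -> Prop)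
  (B : (X -> R) -> Prop) (loss : R -> R -> R) (eps delta : R) : Prop :=
  exists (L : nat -> list (X * R) -> X -> R) (v : nat -> R),
    (forall j, 0 <= v j) /\ is_series v 1 /\
    (forall j smp x, -1 <= L j smp x <= 1) /\
    forall mu : dist X, realizable S mu ->
      Series (fun j => v j * sprob mu n (fun smp =>
         forall b, B b -> risk mu loss (L j smp) <= risk mu loss b + eps))
      >= 1 - delta.

Definition numCompR_le {X : Type} (S : (X -> option R) -> Prop)
  (B : (X -> R) -> Prop) (loss : R -> R -> R) (eps delta N : R) : Prop :=
  exists n : nat, INR n <= N /\ CompR n S B loss eps delta.

Definition log2 (u : R) : R := ln u / ln 2.
Definition log_plus (u : R) : R := log2 (Rmax 2 u).

(* Main.v *)
(** For fixed [x] the conditional loss [L(q, a)], [q = s x], is convex in [a] and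
affine in [q].  Cut [[-1, 1]] into cells.  On a cell starting at [c] the
increment of [L(q, .)] has the form [A + q B], so its sign changes at a constant
threshold [r] of [q]: a predictor competes with [b] as soon as, on every cell,
it steps up where both [s] (relative to [r]) and [b] (relative to [c]) ask for
it and does not where both refuse; where they disagree either choice is harmless
by convexity.  This is realizable learning of the partial class of agreements
between [thr r eta1 s] and [thr c eta2 b], whose VC dimension is at most [m].
The one-inclusion learner with [t] examples errs on a fraction [2 m / (t + 1)],
so for every sample some predictor described by [O(m / beta^2)] sample points is
nearly as good as [b] on that sample.  Empirical risk minimization over all such
descriptions then succeeds by an exponential-moment bound for sample
compression. *)

Require Import Defs.
From Stdlib Require Import Reals List Lia Lra Bool Arith ClassicalEpsilon
  FunctionalExtensionality PropExtensionality.
From Coquelicot Require Import Coquelicot.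
Import ListNotations Defs.

Open Scope nat_scope.

(** * One-inclusion graphs *)

(** The obstacle is that [S] and [B] need not be learnable by themselves: bounded VC dimension is
    available only on points where both clear their margins and agree, and the labels there depend
    on the unknown [s] and [b]. Labels are therefore part of a description: each entry is a sample
    index with one of three labels, star included, and the [(3 n) ^ T] descriptions, [T = G * t],
    cover every possible labelling. The description that serves a given sample depends on that
    sample, so concentration is required for all descriptions at once, in two forms: the loss on
    observed labels against the risk, for the minimizer, and the conditional loss at the sample
    points against the loss on observed labels, for the good description. Cells are learned
    separately, and their answers at a point need not be monotone in the cell. Only the number of
    affirmative answers is used, as the height of the prediction; convexity makes this no worse than
    the set of cells actually chosen. The factor 2 in the error fraction comes from orienting edges
    greedily, which bounds out-degrees by twice the edge density. *)

Fixpoint cube_sum (n : nat) (F : list bool -> nat) : nat :=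
  match n with
  | O => F []
  | S n' => cube_sum n' (fun v => F (true :: v))
            + cube_sum n' (fun v => F (false :: v))
  end.

Definition cube_card (n : nat) (V : list bool -> bool) : nat :=
  cube_sum n (fun v => Nat.b2n (V v)).

Lemma cube_sum_le (n : nat) (F G : list bool -> nat) :
  (forall v, length v = n -> F v <= G v) -> cube_sum n F <= cube_sum n G.
Proof.
  revert F G; induction n as [|n IH]; intros F G H; simpl.
  - apply H; reflexivity.
  - apply Nat.add_le_mono; apply IH; intros v Hv; apply H; simpl; lia.
Qed.

Lemma cube_sum_ext (n : nat) (F G : list bool -> nat) :
  (forall v, length v = n -> F v = G v) -> cube_sum n F = cube_sum n G.
Proof.
  intros H; apply Nat.le_antisymm; apply cube_sum_le; intros v Hv;
    rewrite (H v Hv); lia.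
Qed.

Lemma cube_sum_lt (n : nat) (F G : list bool -> nat) (w : list bool) :
  (forall v, length v = n -> F v <= G v) -> length w = n -> F w < G w ->
  cube_sum n F < cube_sum n G.
Proof.
  revert F G w; induction n as [|n IH]; intros F G w H Hw Hlt; simpl.
  - destruct w; simpl in Hw; [assumption|lia].
  - destruct w as [|c w]; simpl in Hw; [lia|].
    assert (H1 : forall c' v, length v = n -> F (c' :: v) <= G (c' :: v))
      by (intros; apply H; simpl; lia).
    pose proof (cube_sum_le n _ _ (H1 true)).
    pose proof (cube_sum_le n _ _ (H1 false)).
    assert (Hw' : length w = n) by lia.
    destruct c.
    + pose proof (IH _ _ w (H1 true) Hw' Hlt); lia.
    + pose proof (IH _ _ w (H1 false) Hw' Hlt); lia.
Qed.

Lemma cube_sum_add (n : nat) (F G : list bool -> nat) :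
  cube_sum n (fun v => F v + G v) = cube_sum n F + cube_sum n G.
Proof.
  revert F G; induction n as [|n IH]; intros F G; simpl; [reflexivity|].
  rewrite !IH; lia.
Qed.

Lemma cube_sum_mul (n k : nat) (F : list bool -> nat) :
  cube_sum n (fun v => k * F v) = k * cube_sum n F.
Proof.
  revert F; induction n as [|n IH]; intros F; simpl; [reflexivity|].
  rewrite !IH; lia.
Qed.

Lemma cube_card_modular (n : nat) (A B : list bool -> bool) :
  cube_card n A + cube_card n B
  = cube_card n (fun v => A v || B v) + cube_card n (fun v => A v && B v).
Proof.
  unfold cube_card; rewrite <- !cube_sum_add; apply cube_sum_ext.
  intros v _; destruct (A v), (B v); reflexivity.
Qed.

Lemma cube_card_mono (n : nat) (A B : list bool -> bool) :
  (forall v, A v = true -> B v = true) -> cube_card n A <= cube_card n B.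
Proof.
  intros H; apply cube_sum_le; intros v _; specialize (H v).
  destruct (A v), (B v); simpl; auto; discriminate H; reflexivity.
Qed.

Fixpoint cube_edges (n : nat) (V : list bool -> bool) : nat :=
  match n with
  | O => 0
  | S n' => cube_edges n' (fun v => V (true :: v))
            + cube_edges n' (fun v => V (false :: v))
            + cube_card n' (fun v => V (true :: v) && V (false :: v))
  end.

(** An edge inside [A] or inside [B] lies inside the union, and an edge inside both lies inside the
    intersection. The union may also contain edges joining [A] to [B], hence only an inequality. *)
Lemma cube_edges_supermodular (n : nat) (A B : list bool -> bool) :
  cube_edges n A + cube_edges n B
  <= cube_edges n (fun v => A v || B v) + cube_edges n (fun v => A v && B v).
Proof.
  revert A B; induction n as [|n IH]; intros A B; simpl; [lia|].
  pose proof (IH (fun v => A (true :: v)) (fun v => B (true :: v))).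
  pose proof (IH (fun v => A (false :: v)) (fun v => B (false :: v))).
  pose proof (cube_card_modular n (fun v => A (true :: v) && A (false :: v))
                (fun v => B (true :: v) && B (false :: v))) as Hm.
  cbv beta in *.
  assert (cube_card n (fun v => A (true :: v) && A (false :: v)
                                || B (true :: v) && B (false :: v))
          <= cube_card n (fun v => (A (true :: v) || B (true :: v))
                                && (A (false :: v) || B (false :: v)))).
  { apply cube_card_mono; intros v.
    destruct (A (true :: v)), (B (true :: v)), (A (false :: v)), (B (false :: v));
      simpl; auto. }
  assert (cube_card n (fun v => A (true :: v) && A (false :: v)
                                && (B (true :: v) && B (false :: v)))
          <= cube_card n (fun v => (A (true :: v) && B (true :: v))
                                && (A (false :: v) && B (false :: v)))).
  { apply cube_card_mono; intros v.
    destruct (A (true :: v)), (B (true :: v)), (A (false :: v)), (B (false :: v));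
      simpl; auto. }
  lia.
Qed.

(** Shattering evaluated one coordinate at a time: an unmarked coordinate is projected away, a
    marked one must leave the rest shattered for either value. [cube_shatters_select] recovers the
    usual form. *)
Fixpoint cube_shatters (mask : list bool) (V : list bool -> bool) : Prop :=
  match mask with
  | [] => V [] = true
  | true :: mk => cube_shatters mk (fun v => V (true :: v))
                  /\ cube_shatters mk (fun v => V (false :: v))
  | false :: mk => cube_shatters mk (fun v => V (true :: v) || V (false :: v))
  end.

Definition ntrue (mask : list bool) : nat := length (filter (fun c => c) mask).

Lemma cube_shatters_mono (mask : list bool) (A B : list bool -> bool) :
  (forall v, A v = true -> B v = true) ->
  cube_shatters mask A -> cube_shatters mask B.
Proof.
  revert A B; induction mask as [|c mask IH]; intros A B H HA; simpl in *.
  - auto.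
  - destruct c.
    + destruct HA as [H1 H2]; split; [revert H1|revert H2]; apply IH; auto.
    + revert HA; apply IH; intros v Hv.
      apply orb_true_iff in Hv; apply orb_true_iff; destruct Hv; auto.
Qed.

(* Splitting on the first coordinate, the union of the two halves keeps the VC
   dimension and their intersection loses one. *)
Lemma cube_edges_density (n : nat) (V : list bool -> bool) (D : nat) :
  (forall mask, length mask = n -> cube_shatters mask V -> ntrue mask < D) ->
  cube_edges n V + cube_card n V <= D * cube_card n V.
Proof.
  revert V D; induction n as [|n IH]; intros V D H; simpl.
  - unfold cube_card; simpl. specialize (H [] eq_refl); simpl in H.
    destruct (V []); simpl; [|lia]. specialize (H eq_refl); unfold ntrue in H; simpl in H; lia.
  - set (A := fun v => V (true :: v)); set (B := fun v => V (false :: v)).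
    pose proof (cube_edges_supermodular n A B) as HE.
    pose proof (cube_card_modular n A B) as HC.
    assert (HU : cube_edges n (fun v => A v || B v)
                 + cube_card n (fun v => A v || B v)
                 <= D * cube_card n (fun v => A v || B v)).
    { apply IH; intros mask Hl Hs.
      apply (H (false :: mask)); [simpl; lia|exact Hs]. }
    assert (HI : cube_edges n (fun v => A v && B v)
                 + cube_card n (fun v => A v && B v)
                 <= (D - 1) * cube_card n (fun v => A v && B v)).
    { apply IH; intros mask Hl Hs.
      enough (ntrue (true :: mask) < D) by (unfold ntrue in *; simpl in *; lia).
      apply H; [simpl; lia|]; simpl; split; revert Hs; apply cube_shatters_mono;
        intros v Hv; apply andb_true_iff in Hv; tauto. }
    change (cube_card (S n) V) with (cube_card n A + cube_card n B).
    change (fun v => V (true :: v) && V (false :: v)) with (fun v => A v && B v).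
    (* The strict bound in [D] makes [D = 0] the case of an empty [V]: then [HU] already says that
       the union has no vertex, and the truncated [D - 1] does no harm. *)
    destruct D as [|D]; simpl in *; [|rewrite ?Nat.sub_0_r in HI]; nia.
Qed.

Fixpoint flip (i : nat) (v : list bool) : list bool :=
  match v, i with
  | [], _ => []
  | c :: v', O => negb c :: v'
  | c :: v', S i' => c :: flip i' v'
  end.

Definition count_below (n : nat) (p : nat -> bool) : nat :=
  length (filter p (seq 0 n)).

Lemma filter_map_length {A B : Type} (f : A -> B) (p : B -> bool) (l : list A) :
  length (filter p (map f l)) = length (filter (fun a => p (f a)) l).
Proof.
  induction l as [|a l IH]; simpl; [reflexivity|].
  destruct (p (f a)); simpl; rewrite IH; reflexivity.
Qed.

Lemma count_below_S (n : nat) (p : nat -> bool) :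
  count_below (S n) p = Nat.b2n (p 0) + count_below n (fun i => p (S i)).
Proof.
  unfold count_below; simpl seq; rewrite <- seq_shift; simpl.
  destruct (p 0); simpl; rewrite filter_map_length; reflexivity.
Qed.

(** Handshake identity: every edge is met from both of its ends. *)
Lemma cube_degree_sum (n : nat) (V : list bool -> bool) :
  cube_sum n (fun v => if V v then count_below n (fun i => V (flip i v)) else 0)
  = 2 * cube_edges n V.
Proof.
  revert V; induction n as [|n IH]; intros V.
  - simpl; destruct (V []); reflexivity.
  - simpl cube_sum; simpl cube_edges.
    assert (Hc : forall c, cube_sum n (fun v => if V (c :: v)
               then count_below (S n) (fun i => V (flip i (c :: v))) else 0)
             = 2 * cube_edges n (fun v => V (c :: v))
               + cube_card n (fun v => V (true :: v) && V (false :: v))).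
    { intros c; rewrite <- IH; unfold cube_card; rewrite <- cube_sum_add.
      apply cube_sum_ext; intros v _; rewrite count_below_S.
      destruct c; simpl; destruct (V (true :: v)), (V (false :: v)); simpl; lia. }
    rewrite !Hc; lia.
Qed.

(* Every nonempty set of VC dimension at most [d] has a vertex of degree at
   most [2 * d]; charge its edges to it and remove it. *)
Lemma cube_orientation (n d : nat) (V : list bool -> bool) :
  (forall mask, length mask = n -> cube_shatters mask V -> ntrue mask <= d) ->
  exists c : list bool -> nat -> bool,
    (forall v, length v = n -> V v = true -> count_below n (c v) <= 2 * d) /\
    (forall v i, length v = n -> V v = true -> V (flip i v) = true ->
       c v i = true \/ c (flip i v) i = true).
Proof.
  remember (cube_card n V) as N eqn:HN.
  revert V HN; induction N as [N IH] using (well_founded_induction lt_wf).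
  intros V -> Hvc.
  destruct (classic (exists v, length v = n /\ V v = true)) as [[w [Hw HVw]]|Hno].
  2:{ exists (fun _ _ => false); split; intros v; intros; exfalso; eauto. }
  assert (Hlow : exists v, length v = n /\ V v = true /\
            count_below n (fun i => V (flip i v)) <= 2 * d).
  (* If all degrees exceeded [2 * d], the handshake identity would give more than [d] edges per
     vertex, against the density bound. *)
  { apply NNPP; intros Hhigh.
    assert (H1 : (2 * d + 1) * cube_card n V <= 2 * cube_edges n V).
    { rewrite <- cube_degree_sum; unfold cube_card; rewrite <- cube_sum_mul.
      apply cube_sum_le; intros v Hv; destruct (V v) eqn:HV; simpl Nat.b2n; [|lia].
      apply Nat.nlt_ge; intros Hlt; apply Hhigh; exists v; repeat split; auto; lia. }
    assert (H2 : cube_edges n V + cube_card n V <= S d * cube_card n V).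
    { apply cube_edges_density; intros mask Hl Hs; specialize (Hvc mask Hl Hs); lia. }
    assert (H3 : cube_sum n (fun _ => 0) < cube_card n V).
    { apply cube_sum_lt with (w := w); auto; [intros; lia|].
      rewrite HVw; simpl; lia. }
    nia. }
  destruct Hlow as [v0 [Hl0 [HV0 Hdeg]]].
  set (eqv := fun v => if list_eq_dec bool_dec v v0 then true else false).
  set (V' := fun v => V v && negb (eqv v)).
  assert (HV' : forall v, V' v = true -> V v = true)
    by (unfold V'; intros v Hv; apply andb_true_iff in Hv; tauto).
  destruct (IH (cube_card n V')) with (V := V') as [c' [Hc1 Hc2]]; auto.
  { apply cube_sum_lt with (w := v0); auto.
    - intros v _; specialize (HV' v); destruct (V' v), (V v); simpl; auto;
        discriminate HV'; reflexivity.
    - unfold V', eqv; rewrite HV0; destruct (list_eq_dec bool_dec v0 v0);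
        simpl; [lia|congruence]. }
  { intros mask Hl Hs; apply Hvc; auto; revert Hs; apply cube_shatters_mono; auto. }
  exists (fun v i => if eqv v then V (flip i v) else c' v i); split.
  - intros v Hl Hv; unfold eqv; destruct (list_eq_dec bool_dec v v0) as [->|Hne];
      [exact Hdeg|].
    apply Hc1; auto; unfold V', eqv; rewrite Hv;
      destruct (list_eq_dec bool_dec v v0); [contradiction|reflexivity].
  - intros v i Hl Hv Hf.
    destruct (eqv v) eqn:E1; [left; exact Hf|].
    destruct (eqv (flip i v)) eqn:E2.
    + right; replace (flip i (flip i v)) with v; [exact Hv|].
      clear; revert i; induction v as [|c v IHv]; intros [|i]; simpl; auto.
      * rewrite negb_involutive; reflexivity.
      * f_equal; apply IHv.
    + apply Hc2; auto; unfold V'; rewrite ?Hv, ?Hf, ?E1, ?E2; reflexivity.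
Qed.

Fixpoint select {A : Type} (mask : list bool) (l : list A) : list A :=
  match mask, l with
  | c :: mk, a :: l' => if c then a :: select mk l' else select mk l'
  | _, _ => []
  end.

Lemma cube_shatters_select (mask : list bool) (V : list bool -> bool) (w : list bool) :
  cube_shatters mask V -> length w = ntrue mask ->
  exists v, length v = length mask /\ V v = true /\ select mask v = w.
Proof.
  revert V w; induction mask as [|c mask IH]; intros V w HS Hw.
  - exists []; destruct w; [auto|discriminate Hw].
  - destruct c; simpl in HS.
    + destruct w as [|a w]; [discriminate Hw|].
      injection Hw as Hw. destruct HS as [H1 H2].
      destruct a; [destruct (IH _ w H1 Hw) as [v [? [? ?]]]
                  |destruct (IH _ w H2 Hw) as [v [? [? ?]]]].
      * exists (true :: v); simpl; repeat split; auto; congruence.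
      * exists (false :: v); simpl; repeat split; auto; congruence.
    + destruct (IH _ w HS Hw) as [v [? [HV ?]]].
      apply orb_true_iff in HV; destruct HV as [HV|HV].
      * exists (true :: v); simpl; auto.
      * exists (false :: v); simpl; auto.
Qed.

Lemma nth_error_select {A : Type} (mask : list bool) (l : list A) (i : nat) (x : A) :
  nth_error (select mask l) i = Some x ->
  exists j, nth_error l j = Some x /\ forall v : list bool,
    length v = length mask -> nth_error (select mask v) i = nth_error v j.
Proof.
  revert l i; induction mask as [|c mask IH]; intros l i H; simpl in H;
    [destruct i; discriminate H|].
  destruct l as [|a l]; [destruct i; discriminate H|].
  destruct c; [destruct i as [|i]|].
  - exists 0; split; [exact H|].
    intros [|b v] Hv; [discriminate Hv|reflexivity].
  - destruct (IH l i H) as [j [Hj Hv]]; exists (S j); split; [exact Hj|].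
    intros [|b v] Hl; [discriminate Hl|]; simpl; apply Hv; simpl in Hl; lia.
  - destruct (IH l i H) as [j [Hj Hv]]; exists (S j); split; [exact Hj|].
    intros [|b v] Hl; [discriminate Hl|]; simpl; apply Hv; simpl in Hl; lia.
Qed.

Lemma select_incl {A : Type} (mask : list bool) (l : list A) (x : A) :
  In x (select mask l) -> In x l.
Proof.
  revert l; induction mask as [|c mask IH]; intros [|a l] H; simpl in *; try tauto.
  destruct c; simpl in H; [destruct H; auto|auto].
Qed.

Lemma select_NoDup {A : Type} (mask : list bool) (l : list A) :
  NoDup l -> NoDup (select mask l).
Proof.
  revert l; induction mask as [|c mask IH]; intros [|a l] H; simpl; try constructor.
  inversion H as [|? ? Hn Hd]; subst.
  destruct c; [constructor|]; auto.
  intros Hin; apply Hn; revert Hin; apply select_incl.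
Qed.

Lemma select_length {A : Type} (mask : list bool) (l : list A) :
  length l = length mask -> length (select mask l) = ntrue mask.
Proof.
  unfold ntrue; revert l; induction mask as [|c mask IH]; intros [|a l] H; simpl in *;
    try discriminate H; auto.
  destruct c; simpl; rewrite IH; lia.
Qed.

(** * The one-inclusion graph of a partial class on a list of points *)

Definition VC_le {X : Type} (K : (X -> option bool) -> Prop) (d : nat) : Prop :=
  forall xs : list X, NoDup xs -> shatters K xs -> length xs <= d.

(** Only hypotheses defined on all of [l] contribute a vertex. Discarding the others keeps the graph
    inside an ordinary Boolean cube although the class is partial. *)
Definition realized {X : Type} (K : (X -> option bool) -> Prop) (l : list X)
  (v : list bool) : bool :=
  if excluded_middle_informative
       (exists k, K k /\ forall i x, nth_error l i = Some x ->
                         k x = Some (nth i v false))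
  then true else false.

Lemma realized_VC {X : Type} (K : (X -> option bool) -> Prop) (l : list X) (d : nat) :
  VC_le K d -> NoDup l ->
  forall mask, length mask = length l -> cube_shatters mask (realized K l) ->
    ntrue mask <= d.
Proof.
  intros HK Hl mask Hlen HS.
  rewrite <- (select_length mask l) by auto.
  apply HK; [apply select_NoDup, Hl|].
  intros xi.
  destruct (cube_shatters_select mask _ (map xi (seq 0 (ntrue mask))) HS)
    as [v [Hv1 [Hv2 Hv3]]]; [rewrite length_map, length_seq; reflexivity|].
  unfold realized in Hv2; destruct (excluded_middle_informative _) as [[k [Hk Hk']]|];
    [|discriminate Hv2].
  exists k; split; [exact Hk|]; intros i x Hix.
  assert (Hi : i < ntrue mask).
  { rewrite <- (select_length mask l) by auto; apply nth_error_Some; congruence. }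
  destruct (nth_error_select _ _ _ _ Hix) as [j [Hj Hsel]].
  rewrite (Hk' j x Hj); f_equal; apply nth_error_nth.
  rewrite <- Hsel, Hv3, nth_error_map, nth_error_seq by auto.
  destruct (Nat.ltb_spec i (ntrue mask)); [reflexivity|lia].
Qed.

(** An orientation of the one-inclusion graph, indexed by points instead of coordinates: [c v x]
    says that vertex [v] pays for the edge in direction [x]. Writing vertices as [map chi l] turns
    an edge into a pair of labellings that differ at [x] only. *)
Definition charges {X : Type} (K : (X -> option bool) -> Prop) (d : nat) (l : list X)
  (c : list bool -> X -> bool) : Prop :=
  (forall v, length v = length l -> realized K l v = true ->
     length (filter (c v) l) <= 2 * d) /\
  (forall (chi chi' : X -> bool) x, In x l ->
     (forall z, z <> x -> chi z = chi' z) -> chi x = negb (chi' x) ->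
     realized K l (map chi l) = true -> realized K l (map chi' l) = true ->
     c (map chi l) x = true \/ c (map chi' l) x = true).

Lemma flip_map {X : Type} (chi chi' : X -> bool) (x : X) (l : list X) (i : nat) :
  NoDup l -> nth_error l i = Some x ->
  (forall z, z <> x -> chi z = chi' z) -> chi x = negb (chi' x) ->
  flip i (map chi l) = map chi' l.
Proof.
  intros Hl Hi Hz Hx; revert i Hi; induction l as [|a l IH]; intros [|i] Hi;
    try discriminate Hi; inversion Hl as [|? ? Hn Hd]; subst; simpl in *.
  - injection Hi as ->; rewrite Hx, negb_involutive; f_equal.
    apply map_ext_in; intros z Hin; apply Hz; intros ->; contradiction.
  - f_equal; [|apply IH; auto].
    apply Hz; intros ->; apply Hn; revert Hi; apply nth_error_In.
Qed.

Lemma charges_exist {X : Type} (K : (X -> option bool) -> Prop) (d : nat) (l : list X) :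
  VC_le K d -> NoDup l -> exists c, charges K d l c.
Proof.
  intros HK Hl.
  destruct (cube_orientation (length l) d (realized K l)) as [c [Hc1 Hc2]];
    [apply realized_VC; auto|].
  set (idx := fun x => epsilon (inhabits 0) (fun i => nth_error l i = Some x)).
  assert (Hidx : forall x, In x l -> nth_error l (idx x) = Some x).
  { intros x Hx; unfold idx; apply epsilon_spec; apply In_nth_error, Hx. }
  assert (Hidx' : forall i x, nth_error l i = Some x -> idx x = i).
  { intros i x Hi. pose proof (Hidx x (nth_error_In _ _ Hi)) as Hj.
    apply (proj1 (NoDup_nth_error l) Hl); [apply nth_error_Some; congruence|congruence]. }
  exists (fun v x => c v (idx x)); split.
  - intros v Hv Hr; eapply Nat.le_trans; [|apply (Hc1 v Hv Hr)].
    unfold count_below; rewrite <- (filter_map_length idx (c v)).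
    apply NoDup_incl_length.
    + apply NoDup_filter. apply NoDup_map_NoDup_ForallPairs; auto.
      intros x y Hx Hy E. pose proof (Hidx x Hx); pose proof (Hidx y Hy); congruence.
    + intros i Hi; apply filter_In in Hi; destruct Hi as [Hi Hc].
      apply filter_In; split; auto.
      apply in_map_iff in Hi; destruct Hi as [x [<- Hx]].
      apply in_seq; split; [lia|]; simpl; apply nth_error_Some.
      rewrite (Hidx x Hx); discriminate.
  - intros chi chi' x Hx Hz Hxx Hr Hr'.
    pose proof (flip_map chi chi' x l (idx x) Hl (Hidx x Hx) Hz Hxx) as Hf.
    rewrite <- Hf in *. apply Hc2; auto. apply length_map.
Qed.

(** * The one-inclusion learner and its leave-one-out error *)

Definition canon {X : Type} (u : list X) : list X :=
  epsilon (inhabits []) (fun l => NoDup l /\ forall z, In z l <-> In z u).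

Lemma canon_spec {X : Type} (u : list X) :
  NoDup (canon u) /\ forall z, In z (canon u) <-> In z u.
Proof.
  apply (epsilon_spec (inhabits []) (fun l => NoDup l /\ forall z, In z l <-> In z u)).
  exists (nodup (fun x y => excluded_middle_informative (x = y)) u); split.
  - apply NoDup_nodup.
  - intros z; apply nodup_In.
Qed.

(** The enumeration, and with it the orientation that [epsilon] picks, depends only on the set of
    points. All leave-one-out problems of one sample that hide an otherwise unseen point thus
    consult the same oriented graph. *)
Lemma canon_ext {X : Type} (u u' : list X) :
  (forall z, In z u <-> In z u') -> canon u = canon u'.
Proof.
  intros H; unfold canon; f_equal; extensionality l.
  apply propositional_extensionality; split; intros [H1 H2]; split; auto;
    intros z; rewrite H2; [|symmetry]; apply H.
Qed.

Definition labelled_points {X : Type} (D : list (X * option bool)) : list X :=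
  map fst (filter (fun p => match snd p with None => false | Some _ => true end) D).

Definition label_of {X : Type} (D : list (X * option bool)) (z : X) : bool :=
  if excluded_middle_informative (In (z, Some true) D) then true else false.

Definition completion {X : Type} (D : list (X * option bool)) (x : X) (c : bool)
  (z : X) : bool :=
  if excluded_middle_informative (z = x) then c else label_of D z.

(** When both completions are realized they are the two ends of an edge. The prediction avoids the
    end that pays for it, so that an error occurs only when the true labelling is a vertex charged
    in direction [x]. *)
Definition one_inclusion {X : Type} (K : (X -> option bool) -> Prop) (d : nat)
  (D : list (X * option bool)) (x : X) : bool :=
  if excluded_middle_informative (In x (labelled_points D)) then label_of D x
  else
    let l := canon (x :: labelled_points D) in
    let c := epsilon (inhabits (fun _ _ => false)) (charges K d l) in
    let pattern b := map (completion D x b) l in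
    if realized K l (pattern true) then
      if realized K l (pattern false) then negb (c (pattern true) x) else true
    else false.

Definition remove_at {A : Type} (i : nat) (u : list A) : list A :=
  firstn i u ++ skipn (S i) u.

Definition mistake {X : Type} (A : list (X * option bool) -> X -> bool)
  (k : X -> option bool) (u : list X) (x : X) : bool :=
  match k x with
  | None => false
  | Some c => negb (eqb (A (map (fun z => (z, k z)) u) x) c)
  end.

Lemma In_labelled_points {X : Type} (k : X -> option bool) (u : list X) (z : X) :
  In z (labelled_points (map (fun z => (z, k z)) u)) <-> In z u /\ k z <> None.
Proof.
  unfold labelled_points; rewrite in_map_iff; split.
  - intros [[z' c] [E H]]; simpl in E; subst z'.
    apply filter_In in H; destruct H as [H1 H2].
    apply in_map_iff in H1; destruct H1 as [z' [E H1]].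
    injection E as -> <-; split; auto; intros E; simpl in H2; rewrite E in H2; discriminate H2.
  - intros [H1 H2]; exists (z, k z); split; auto; apply filter_In; split.
    + apply in_map_iff; exists z; auto.
    + simpl; destruct (k z); [reflexivity|contradiction].
Qed.

Lemma label_of_labelled {X : Type} (k : X -> option bool) (u : list X) (z : X) (c : bool) :
  In z u -> k z = Some c -> label_of (map (fun z => (z, k z)) u) z = c.
Proof.
  intros Hz Hk; unfold label_of; destruct (excluded_middle_informative _) as [H|H].
  - apply in_map_iff in H; destruct H as [z' [E H]]; injection E as -> E; congruence.
  - destruct c; auto; exfalso; apply H; apply in_map_iff; exists z; split; congruence.
Qed.

Lemma In_remove_at {A : Type} (i j : nat) (u : list A) (x : A) :
  nth_error u j = Some x -> j <> i -> In x (remove_at i u).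
Proof.
  intros Hj Hne; unfold remove_at; apply in_or_app.
  destruct (Nat.lt_ge_cases j i) as [Hlt|Hge].
  - left; apply nth_error_In with (n := j); rewrite nth_error_firstn.
    destruct (Nat.ltb_spec j i); [exact Hj|lia].
  - right; apply nth_error_In with (n := j - S i); rewrite nth_error_skipn.
    replace (S i + (j - S i)) with j by lia; exact Hj.
Qed.

Lemma remove_at_incl {A : Type} (i : nat) (u : list A) (x : A) :
  In x (remove_at i u) -> In x u.
Proof.
  unfold remove_at; intros H; apply in_app_or in H; destruct H as [H|H].
  - rewrite <- (firstn_skipn i u); apply in_or_app; auto.
  - rewrite <- (firstn_skipn (S i) u); apply in_or_app; auto.
Qed.

(** A mistake at position [i] means that the point occurs nowhere else in [u] and that the vertex of
    the true labelling is charged in its direction. Mistakes therefore inject into the at most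
    [2 * d] directions charged to that single vertex. *)
Lemma one_inclusion_leave_one_out {X : Type} (K : (X -> option bool) -> Prop) (d : nat)
  (k : X -> option bool) (u : list X) (x0 : X) :
  VC_le K d -> K k ->
  count_below (length u)
    (fun i => mistake (one_inclusion K d) k (remove_at i u) (nth i u x0)) <= 2 * d.
Proof.
  intros HK Hk.
  set (l := canon (labelled_points (map (fun z => (z, k z)) u))).
  destruct (canon_spec (labelled_points (map (fun z => (z, k z)) u))) as [Hnd Hin].
  fold l in Hnd, Hin.
  set (c := epsilon (inhabits (fun _ _ => false)) (charges K d l)).
  assert (Hc : charges K d l c)
    by (unfold c; apply epsilon_spec; apply charges_exist; auto).
  set (chi := fun z => match k z with Some b => b | None => false end).
  assert (Hreal : realized K l (map chi l) = true).
  { unfold realized; destruct (excluded_middle_informative _) as [|H]; auto.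
    exfalso; apply H; exists k; split; auto; intros i x Hi.
    erewrite nth_error_nth by (rewrite nth_error_map, Hi; reflexivity).
    assert (Hx : In x l) by (revert Hi; apply nth_error_In).
    apply Hin, In_labelled_points in Hx; unfold chi; destruct (k x); tauto. }
  assert (Hmain : forall i, i < length u ->
    mistake (one_inclusion K d) k (remove_at i u) (nth i u x0) = true ->
    In (nth i u x0) l /\ c (map chi l) (nth i u x0) = true /\
    ~ In (nth i u x0) (remove_at i u)).
  { intros i Hi Hm; unfold mistake in Hm.
    assert (Hux : nth_error u i = Some (nth i u x0)) by (apply nth_error_nth'; auto).
    set (x := nth i u x0) in *.
    destruct (k x) as [b|] eqn:Hkx; [|discriminate Hm].
    set (D := map (fun z => (z, k z)) (remove_at i u)) in *.
    unfold one_inclusion in Hm.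
    destruct (excluded_middle_informative (In x (labelled_points D))) as [Hx|Hx].
    { exfalso; apply In_labelled_points in Hx; unfold D in Hm.
      rewrite (label_of_labelled k _ x b) in Hm by tauto.
      rewrite eqb_reflx in Hm; discriminate Hm. }
    assert (Hx' : ~ In x (remove_at i u))
      by (intros H; apply Hx, In_labelled_points; split; auto; congruence).
    assert (El : canon (x :: labelled_points D) = l).
    { unfold l; apply canon_ext; intros z; simpl.
      unfold D; rewrite !In_labelled_points; split.
      - intros [<-|[H1 H2]].
        + split; [revert Hux; apply nth_error_In|congruence].
        + split; auto; revert H1; apply remove_at_incl.
      - intros [H1 H2]; destruct (In_nth_error _ _ H1) as [j Hj].
        destruct (Nat.eq_dec j i) as [->|Hne]; [left; congruence|].
        right; split; auto; apply In_remove_at with (j := j); auto. }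
    rewrite El in Hm; fold c in Hm.
    assert (Hxl : In x l).
    { apply Hin, In_labelled_points; split; [revert Hux; apply nth_error_In|congruence]. }
    assert (Eb : map (completion D x b) l = map chi l).
    { apply map_ext_in; intros z Hz; unfold completion.
      destruct (excluded_middle_informative (z = x)) as [->|Hne].
      - unfold chi; rewrite Hkx; reflexivity.
      - apply Hin, In_labelled_points in Hz; destruct Hz as [Hz1 Hz2].
        destruct (In_nth_error _ _ Hz1) as [j Hj].
        assert (Hzr : In z (remove_at i u)).
        { apply In_remove_at with (j := j); auto; intros ->; congruence. }
        unfold chi, D; destruct (k z) as [b'|] eqn:Ez; [|contradiction].
        apply label_of_labelled; auto. }
    split; [exact Hxl|split; [|exact Hx']].
    destruct Hc as [_ Hc].
    assert (Hedge := Hc (completion D x true) (completion D x false) x Hxl).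
    unfold completion in Hedge at 1 2 3 4.
    cbv zeta in Hm.
    destruct (excluded_middle_informative (x = x)); [|contradiction].
    specialize (fun H => Hedge H eq_refl).
    assert (Hedge' : realized K l (map (completion D x true) l) = true ->
       realized K l (map (completion D x false) l) = true ->
       c (map (completion D x true) l) x = true \/
       c (map (completion D x false) l) x = true).
    { apply Hedge; intros z Hz.
      destruct (excluded_middle_informative (z = x)); [contradiction|reflexivity]. }
    (* The completion with the true label is realized, so a mistake requires the other one to be
       realized too and the orientation to favour it. *)
    destruct b; rewrite Eb in Hm, Hedge'; rewrite Hreal in Hm, Hedge'.
    - destruct (realized K l (map (completion D x false) l)); [|discriminate Hm].
      destruct (c (map chi l) x); [reflexivity|discriminate Hm].
    - destruct (realized K l (map (completion D x true) l)); [|discriminate Hm].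
      destruct (c (map (completion D x true) l) x) eqn:E; [discriminate Hm|].
      destruct Hedge' as [H|H]; auto; discriminate H. }
  destruct Hc as [Hc1 _].
  eapply Nat.le_trans; [|apply (Hc1 (map chi l)); [apply length_map|exact Hreal]].
  unfold count_below.
  rewrite <- (length_map (fun i => nth i u x0)).
  apply NoDup_incl_length.
  - apply NoDup_map_NoDup_ForallPairs; [|apply NoDup_filter, seq_NoDup].
    intros i j Hi Hj E; apply filter_In in Hi, Hj.
    destruct Hi as [Hi Hmi], Hj as [Hj Hmj]; apply in_seq in Hi, Hj.
    (* A point held at two positions is still labelled after one of them is removed, so it causes no
       mistake. *)
    destruct (Nat.eq_dec i j) as [|Hne]; auto; exfalso.
    destruct (Hmain i) as [_ [_ Hni]]; [lia|exact Hmi|].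
    apply Hni, In_remove_at with (j := j); auto.
    rewrite E; apply nth_error_nth'; lia.
  - intros x Hx; apply in_map_iff in Hx; destruct Hx as [i [<- Hi]].
    apply filter_In in Hi; destruct Hi as [Hi Hm]; apply in_seq in Hi.
    destruct (Hmain i) as [H1 [H2 _]]; [lia|exact Hm|].
    apply filter_In; auto.
Qed.

(** * Averaging over training sequences *)

Fixpoint seq_sum {X : Type} (t : nat) (pts : list X) (G : list X -> nat) : nat :=
  match t with
  | O => G []
  | S t' => list_sum (map (fun x => seq_sum t' pts (fun u => G (x :: u))) pts)
  end.

Lemma list_sum_map_le {X : Type} (pts : list X) (F G : X -> nat) :
  (forall x, In x pts -> F x <= G x) -> list_sum (map F pts) <= list_sum (map G pts).
Proof.
  induction pts as [|a pts IH]; intros H; simpl; [lia|].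
  apply Nat.add_le_mono; [apply H; left; auto|apply IH; intros; apply H; right; auto].
Qed.

Lemma list_sum_map_add {X : Type} (pts : list X) (F G : X -> nat) :
  list_sum (map (fun x => F x + G x) pts) = list_sum (map F pts) + list_sum (map G pts).
Proof. induction pts as [|a pts IH]; simpl; [reflexivity|rewrite IH; lia]. Qed.

Lemma list_sum_map_const {X : Type} (pts : list X) (k : nat) :
  list_sum (map (fun _ => k) pts) = length pts * k.
Proof. induction pts as [|a pts IH]; simpl; [reflexivity|rewrite IH; reflexivity]. Qed.

Lemma seq_sum_le {X : Type} (t : nat) (pts : list X) (F G : list X -> nat) :
  (forall u, length u = t -> incl u pts -> F u <= G u) ->
  seq_sum t pts F <= seq_sum t pts G.
Proof.
  revert F G; induction t as [|t IH]; intros F G H; simpl.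
  - apply H; [reflexivity|intros x []].
  - apply list_sum_map_le; intros x Hx; apply IH; intros u Hu Hi; apply H.
    + simpl; lia.
    + apply incl_cons; auto.
Qed.

Lemma seq_sum_add {X : Type} (t : nat) (pts : list X) (F G : list X -> nat) :
  seq_sum t pts (fun u => F u + G u) = seq_sum t pts F + seq_sum t pts G.
Proof.
  revert F G; induction t as [|t IH]; intros F G; simpl; [reflexivity|].
  rewrite <- list_sum_map_add; f_equal; apply map_ext; intros x; apply IH.
Qed.

Lemma seq_sum_const {X : Type} (t : nat) (pts : list X) (k : nat) :
  seq_sum t pts (fun _ => k) = length pts ^ t * k.
Proof.
  induction t as [|t IH]; simpl; [lia|].
  rewrite IH, list_sum_map_const; lia.
Qed.

Lemma seq_sum_swap {X Y : Type} (t : nat) (pts : list X) (qs : list Y)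
  (H : Y -> list X -> nat) :
  list_sum (map (fun y => seq_sum t pts (H y)) qs)
  = seq_sum t pts (fun u => list_sum (map (fun y => H y u) qs)).
Proof.
  induction qs as [|y qs IH]; simpl.
  - rewrite seq_sum_const; lia.
  - rewrite IH, <- seq_sum_add; reflexivity.
Qed.

(** Exchangeability: in a uniform sequence of [t + 1] points, any coordinate may serve as the test
    point and the others as the training sequence. *)
Lemma seq_sum_leave_one_out {X : Type} (t i : nat) (pts : list X) (x0 : X)
  (H : list X -> X -> nat) : i <= t ->
  seq_sum (S t) pts (fun u => H (remove_at i u) (nth i u x0))
  = seq_sum t pts (fun u => list_sum (map (H u) pts)).
Proof.
  revert i H; induction t as [|t IH]; intros i H Hi.
  - replace i with 0 by lia; reflexivity.
  - destruct i as [|i].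
    + rewrite <- seq_sum_swap; reflexivity.
    + change (seq_sum (S (S t)) pts (fun u => H (remove_at (S i) u) (nth (S i) u x0)))
        with (list_sum (map (fun x => seq_sum (S t) pts
               (fun u => H (x :: remove_at i u) (nth i u x0))) pts)).
      change (seq_sum (S t) pts (fun u => list_sum (map (H u) pts)))
        with (list_sum (map (fun x => seq_sum t pts
               (fun u => list_sum (map (H (x :: u)) pts))) pts)).
      f_equal; apply map_ext; intros x.
      apply (IH i (fun u => H (x :: u))); lia.
Qed.

Lemma count_below_sum (n : nat) (p : nat -> bool) :
  count_below n p = list_sum (map (fun i => Nat.b2n (p i)) (seq 0 n)).
Proof.
  unfold count_below; induction (seq 0 n) as [|i l IH]; simpl; [reflexivity|].
  destruct (p i); simpl; rewrite IH; reflexivity.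
Qed.

(** Under uniform sampling from [pts], the leave-one-out bound spread over the [t + 1] positions
    bounds the average number of errors of a training sequence of length [t]; some sequence does no
    worse than average. Sums over all sequences stand for expectations, which keeps the argument in
    [nat]. *)
Lemma short_training_sequence {X : Type} (K : (X -> option bool) -> Prop) (d t : nat)
  (k : X -> option bool) (pts : list X) :
  VC_le K d -> K k -> pts <> [] ->
  exists u, length u = t /\ incl u pts /\
    S t * length (filter (mistake (one_inclusion K d) k u) pts) <= 2 * d * length pts.
Proof.
  intros HK Hk Hne.
  destruct pts as [|x0 pts0] eqn:Epts; [contradiction|]; rewrite <- Epts in *.
  set (H := fun u x => Nat.b2n (mistake (one_inclusion K d) k u x)).
  assert (HH : forall u, length (filter (mistake (one_inclusion K d) k u) pts)
                         = list_sum (map (H u) pts)).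
  { intros u; unfold H; clear; induction pts as [|a l IH]; simpl; [reflexivity|].
    destruct (mistake _ _ _ a); simpl; rewrite IH; reflexivity. }
  assert (Hsum : S t * seq_sum t pts (fun u => list_sum (map (H u) pts))
                 <= length pts ^ S t * (2 * d)).
  { rewrite <- seq_sum_const.
    replace (S t * seq_sum t pts (fun u => list_sum (map (H u) pts)))
      with (list_sum (map (fun _ : nat => seq_sum t pts (fun u => list_sum (map (H u) pts)))
              (seq 0 (S t)))) by (rewrite list_sum_map_const, length_seq; reflexivity).
    replace (map (fun _ : nat => seq_sum t pts (fun u => list_sum (map (H u) pts))) (seq 0 (S t)))
      with (map (fun i => seq_sum (S t) pts (fun u => H (remove_at i u) (nth i u x0))) (seq 0 (S t))).
    2:{ apply map_ext_in; intros i Hi; apply in_seq in Hi.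
        apply seq_sum_leave_one_out; lia. }
    rewrite seq_sum_swap; apply seq_sum_le; intros u Hu _.
    pose proof (one_inclusion_leave_one_out K d k u x0 HK Hk) as HL.
    rewrite Hu, count_below_sum in HL; exact HL. }
  (* Counts being integers, every failing sequence exceeds the bound by at least 1; summing over all
     sequences contradicts [Hsum]. *)
  apply NNPP; intros Hno.
  assert (Hlow : length pts ^ t * (2 * d * length pts + 1)
          <= S t * seq_sum t pts (fun u => list_sum (map (H u) pts))).
  { rewrite <- seq_sum_const.
    assert (E : forall a F, a * seq_sum t pts F = seq_sum t pts (fun u => a * F u)).
    { intros a F; induction a as [|a IHa]; simpl; [rewrite seq_sum_const; lia|].
      rewrite seq_sum_add, IHa; reflexivity. }
    rewrite E; apply seq_sum_le; intros u Hu Hi.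
    rewrite <- HH; apply Nat.nlt_ge; intros Hlt; apply Hno; exists u.
    repeat split; auto; lia. }
  assert (0 < length pts) by (rewrite Epts; simpl; lia).
  assert (0 < length pts ^ t) by (apply Nat.neq_0_lt_0, Nat.pow_nonzero; lia).
  simpl in Hsum; nia.
Qed.

Close Scope nat_scope.
Open Scope R_scope.

(** * Expectation over samples *)

Definition mix {X : Type} (mu : dist X) (F : nat * bool -> R) (i : nat) : R :=
  cp mu i * F (i, true) + (1 - cp mu i) * F (i, false).

Definition mean1 {X : Type} (mu : dist X) (F : nat * bool -> R) : R :=
  Series (fun i => wt mu i * mix mu F i).

(* An atom index and a label stand for a labelled example: equality of indices
   then replaces equality of atoms, which may collide at weight zero. *)
Fixpoint mean {X : Type} (mu : dist X) (n : nat) (F : list (nat * bool) -> R) : R :=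
  match n with
  | O => F []
  | S n' => mean1 mu (fun z => mean mu n' (fun s => F (z :: s)))
  end.

Definition example {X : Type} (mu : dist X) (z : nat * bool) : X * R :=
  (atom mu (fst z), if snd z then 1 else -1).

Lemma sprob_mean {X : Type} (mu : dist X) (n : nat) (E : list (X * R) -> Prop) :
  sprob mu n E = mean mu n (fun s => ind (E (map (example mu) s))).
Proof.
  revert E; induction n as [|n IH]; intros E; simpl; [reflexivity|].
  unfold mean1, mix; apply Series_ext; intros i; rewrite !IH; reflexivity.
Qed.

Lemma Rabs_convex (p a b M : R) :
  0 <= p <= 1 -> Rabs a <= M -> Rabs b <= M -> Rabs (p * a + (1 - p) * b) <= M.
Proof.
  intros Hp Ha Hb; apply Rabs_le; apply Rabs_le_between in Ha, Hb; split; nra.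
Qed.

Lemma mix_abs {X : Type} (mu : dist X) (F : nat * bool -> R) (M : R) (i : nat) :
  (forall z, Rabs (F z) <= M) -> Rabs (mix mu F i) <= M.
Proof. intros H; apply Rabs_convex; auto; apply cp_01. Qed.

Lemma ex_series_wt {X : Type} (mu : dist X) (h : nat -> R) (M : R) :
  (forall i, Rabs (h i) <= M) -> ex_series (fun i => wt mu i * h i).
Proof.
  intros H; apply (ex_series_le (K := R_AbsRing) (V := R_CompleteNormedModule)
           (fun i => wt mu i * h i) (fun i => M * wt mu i)).
  - intros i; unfold norm; simpl; unfold abs; simpl.
    pose proof (wt_ge0 _ mu i).
    rewrite Rabs_mult, Rabs_pos_eq, Rmult_comm by auto.
    apply Rmult_le_compat_r; auto.
  - apply (ex_series_scal_l M (wt mu)); exists 1; apply wt_sum.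
Qed.

Lemma Series_wt {X : Type} (mu : dist X) : Series (wt mu) = 1.
Proof. apply is_series_unique, wt_sum. Qed.

Lemma Series_wt_le {X : Type} (mu : dist X) (h h' : nat -> R) (M : R) :
  (forall i, Rabs (h i) <= M) -> (forall i, Rabs (h' i) <= M) ->
  (forall i, 0 < wt mu i -> h i <= h' i) ->
  Series (fun i => wt mu i * h i) <= Series (fun i => wt mu i * h' i).
Proof.
  intros Hh Hh' Hle.
  enough (0 <= Series (fun i => wt mu i * h' i) - Series (fun i => wt mu i * h i)) by lra.
  rewrite <- Series_minus by (eapply ex_series_wt; eauto).
  replace 0 with (Series (fun _ => 0 * 0)) by (rewrite Series_scal_l; ring).
  apply Series_le.
  - intros i; split; [lra|].
    destruct (wt_ge0 _ mu i) as [Hp|E]; [|rewrite <- E; lra].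
    specialize (Hle i Hp); nra.
  - apply ex_series_ext with (a := fun i => wt mu i * (h' i - h i));
      [intros; apply Rmult_minus_distr_l|].
    apply ex_series_wt with (M := M + M); intros i.
    eapply Rle_trans; [apply Rabs_triang|]; rewrite Rabs_Ropp.
    apply Rplus_le_compat; auto.
Qed.

Lemma mean1_ext {X : Type} (mu : dist X) (F G : nat * bool -> R) :
  (forall z, F z = G z) -> mean1 mu F = mean1 mu G.
Proof. intros H; apply Series_ext; intros i; unfold mix; rewrite !H; reflexivity. Qed.

Lemma mean1_const {X : Type} (mu : dist X) (c : R) : mean1 mu (fun _ => c) = c.
Proof.
  unfold mean1; rewrite (Series_ext _ (fun i => c * wt mu i)).
  - rewrite Series_scal_l, Series_wt; ring.
  - intros i; unfold mix; ring.
Qed.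

Lemma mean1_scal {X : Type} (mu : dist X) (c : R) (F : nat * bool -> R) :
  mean1 mu (fun z => c * F z) = c * mean1 mu F.
Proof.
  unfold mean1; rewrite <- Series_scal_l; apply Series_ext; intros i; unfold mix; ring.
Qed.

Lemma mean1_plus {X : Type} (mu : dist X) (F G : nat * bool -> R) (M : R) :
  (forall z, Rabs (F z) <= M) -> (forall z, Rabs (G z) <= M) ->
  mean1 mu (fun z => F z + G z) = mean1 mu F + mean1 mu G.
Proof.
  intros HF HG; unfold mean1; rewrite <- Series_plus.
  - apply Series_ext; intros i; unfold mix; ring.
  - apply ex_series_wt with (M := M); intros; apply mix_abs; auto.
  - apply ex_series_wt with (M := M); intros; apply mix_abs; auto.
Qed.

Lemma mean1_le {X : Type} (mu : dist X) (F G : nat * bool -> R) (M : R) :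
  (forall z, Rabs (F z) <= M) -> (forall z, Rabs (G z) <= M) ->
  (forall z, 0 < wt mu (fst z) -> F z <= G z) -> mean1 mu F <= mean1 mu G.
Proof.
  intros HF HG H; apply Series_wt_le with (M := M);
    try (intros; apply mix_abs; assumption).
  intros i Hi; unfold mix; pose proof (cp_01 _ mu i).
  pose proof (H (i, true) Hi); pose proof (H (i, false) Hi); nra.
Qed.

Lemma mean1_abs {X : Type} (mu : dist X) (F : nat * bool -> R) (M : R) :
  (forall z, Rabs (F z) <= M) -> Rabs (mean1 mu F) <= M.
Proof.
  intros HF.
  assert (HM : 0 <= M) by (eapply Rle_trans; [apply Rabs_pos|apply (HF (0%nat, true))]).
  apply Rabs_le; split.
  - rewrite <- (mean1_const mu (- M)); apply mean1_le with (M := M); auto.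
    + intros _; rewrite Rabs_Ropp, Rabs_pos_eq; lra.
    + intros z _; specialize (HF z); apply Rabs_le_between in HF; lra.
  - rewrite <- (mean1_const mu M); apply mean1_le with (M := M); auto.
    + intros _; rewrite Rabs_pos_eq; lra.
    + intros z _; specialize (HF z); apply Rabs_le_between in HF; lra.
Qed.

Lemma sum_n_weighted_abs (w h : nat -> R) (M : R) (N : nat) :
  (forall i, 0 <= w i) -> (forall i, Rabs (h i) <= M) ->
  Rabs (sum_n (fun i => w i * h i) N) <= M * sum_n w N.
Proof.
  intros Hw Hh.
  assert (Hi : forall i, Rabs (w i * h i) <= M * w i).
  { intros i; rewrite Rabs_mult, (Rabs_pos_eq (w i)), Rmult_comm by auto.
    apply Rmult_le_compat_r; auto. }
  induction N as [|N IH].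
  - rewrite !sum_O; apply Hi.
  - rewrite !sum_Sn; unfold plus; simpl.
    eapply Rle_trans; [apply Rabs_triang|]; specialize (Hi (S N)); lra.
Qed.

Lemma sum_n_wt_le1 {X : Type} (mu : dist X) (N : nat) : sum_n (wt mu) N <= 1.
Proof.
  apply is_lim_seq_incr_compare with (u := sum_n (wt mu)) (l := 1).
  - apply wt_sum.
  - intros n; rewrite sum_Sn; unfold plus; simpl; pose proof (wt_ge0 _ mu (S n)); lra.
Qed.

Lemma Series_wt_tail {X : Type} (mu : dist X) (h : nat -> R) (M : R) (N : nat) :
  (forall i, Rabs (h i) <= M) ->
  Rabs (Series (fun i => wt mu i * h i) - sum_n (fun i => wt mu i * h i) N)
  <= M * (1 - sum_n (wt mu) N).
Proof.
  intros Hh.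
  assert (Hd : forall n, (N <= n)%nat ->
    Rabs (sum_n (fun i => wt mu i * h i) n - sum_n (fun i => wt mu i * h i) N)
    <= M * (sum_n (wt mu) n - sum_n (wt mu) N)).
  { induction 1 as [|n Hn IH].
    - rewrite !Rminus_diag, Rabs_R0; lra.
    - rewrite !sum_Sn; unfold plus; simpl.
      replace (_ + _ - _) with (sum_n (fun i => wt mu i * h i) n
        - sum_n (fun i => wt mu i * h i) N + wt mu (S n) * h (S n)) by ring.
      eapply Rle_trans; [apply Rabs_triang|].
      assert (Rabs (wt mu (S n) * h (S n)) <= M * wt mu (S n)); [|lra].
      pose proof (wt_ge0 _ mu (S n)).
      rewrite Rabs_mult, (Rabs_pos_eq (wt mu (S n))), Rmult_comm by auto.
      apply Rmult_le_compat_r; auto. }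
  assert (HM : 0 <= M) by (eapply Rle_trans; [apply Rabs_pos|apply (Hh 0%nat)]).
  apply (is_lim_seq_le_loc
    (fun n => Rabs (sum_n (fun i => wt mu i * h i) n - sum_n (fun i => wt mu i * h i) N))
    (fun _ => M * (1 - sum_n (wt mu) N))
    (Finite (Rabs (Series (fun i => wt mu i * h i) - sum_n (fun i => wt mu i * h i) N)))
    (Finite (M * (1 - sum_n (wt mu) N)))).
  - exists N; intros n Hn; eapply Rle_trans; [apply Hd, Hn|].
    apply Rmult_le_compat_l; auto; pose proof (sum_n_wt_le1 mu n); lra.
  - apply (is_lim_seq_abs _ (Finite _)), is_lim_seq_minus'; [|apply is_lim_seq_const].
    apply (Series_correct (fun i => wt mu i * h i)), ex_series_wt with (M := M), Hh.
  - apply is_lim_seq_const.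
Qed.

Lemma sum_n_swap (F : nat -> nat -> R) (N N' : nat) :
  sum_n (fun i => sum_n (F i) N') N = sum_n (fun j => sum_n (fun i => F i j) N) N'.
Proof.
  induction N as [|N IH].
  - rewrite sum_O; apply sum_n_ext; intros j; rewrite sum_O; reflexivity.
  - rewrite sum_Sn, IH, <- sum_n_plus; apply sum_n_ext; intros j; rewrite sum_Sn; reflexivity.
Qed.

(** Truncating the inner series costs at most [M] times the tail weight, uniformly in [i], so sums
    over squares converge to the iterated series. Finite square sums can be transposed, which gives
    the exchange of expectations in [Series_wt_swap]. *)
Lemma is_lim_seq_square_sum {X : Type} (mu : dist X) (H : nat -> nat -> R) (M : R) :
  (forall i j, Rabs (H i j) <= M) ->
  is_lim_seq (fun N => sum_n (fun i => wt mu i * sum_n (fun j => wt mu j * H i j) N) N)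
    (Series (fun i => wt mu i * Series (fun j => wt mu j * H i j))).
Proof.
  intros HH.
  assert (HM : 0 <= M) by (eapply Rle_trans; [apply Rabs_pos|apply (HH 0%nat 0%nat)]).
  assert (HS : forall i, Rabs (Series (fun j => wt mu j * H i j)) <= M).
  { intros i; rewrite (Series_ext _ (fun j => wt mu j * mix mu (fun z => H i (fst z)) j))
      by (intros j; unfold mix; simpl; ring).
    apply mean1_abs; intros z; apply HH. }
  set (A := fun i => Series (fun j => wt mu j * H i j)) in *.
  set (P := (fun N i => sum_n (fun j => wt mu j * H i j) N) : nat -> nat -> R).
  apply is_lim_seq_ext with (u := fun N => sum_n (fun i => wt mu i * A i) N
      - sum_n (fun i => wt mu i * (A i - P N i)) N).
  { intros N; rewrite <- (Rplus_0_r (sum_n (fun i => wt mu i * sum_n _ N) N)).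
    enough (E : sum_n (fun i => wt mu i * A i) N
      = sum_n (fun i => wt mu i * (A i - P N i)) N + sum_n (fun i => wt mu i * P N i) N)
      by (unfold P in *; lra).
    rewrite <- (sum_n_plus (fun i => wt mu i * (A i - P N i)) (fun i => wt mu i * P N i)).
    apply sum_n_ext; intros i; unfold plus; simpl; ring. }
  replace (Finite (Series (fun i => wt mu i * Series (fun j => wt mu j * H i j))))
    with (Finite (Series (fun i => wt mu i * A i) - 0)) by (rewrite Rminus_0_r; reflexivity).
  apply is_lim_seq_minus'.
  - apply (Series_correct (fun i => wt mu i * A i)), ex_series_wt with (M := M), HS.
  - apply is_lim_seq_abs_0.
    apply is_lim_seq_le_le with (u := fun _ => 0)
      (w := fun N => M * (1 - sum_n (wt mu) N)).
    + intros N; split; [apply Rabs_pos|].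
      pose proof (sum_n_wt_le1 mu N) as Hle.
      eapply Rle_trans.
      * apply sum_n_weighted_abs with (M := M * (1 - sum_n (wt mu) N)); [apply wt_ge0|].
        intros i; apply Series_wt_tail, HH.
      * assert (0 <= M * (1 - sum_n (wt mu) N)) by (apply Rmult_le_pos; lra). nra.
    + apply is_lim_seq_const.
    + replace (Finite 0) with (Finite (M * (1 - 1))) by (f_equal; ring).
      apply (is_lim_seq_scal_l _ M (Finite (1 - 1))).
      apply is_lim_seq_minus'; [apply is_lim_seq_const|apply wt_sum].
Qed.

Lemma Series_wt_swap {X : Type} (mu : dist X) (H : nat -> nat -> R) (M : R) :
  (forall i j, Rabs (H i j) <= M) ->
  Series (fun i => wt mu i * Series (fun j => wt mu j * H i j))
  = Series (fun j => wt mu j * Series (fun i => wt mu i * H i j)).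
Proof.
  intros HH.
  pose proof (is_lim_seq_square_sum mu H M HH) as L1.
  pose proof (is_lim_seq_square_sum mu (fun i j => H j i) M (fun i j => HH j i)) as L2.
  apply is_lim_seq_unique in L1.
  apply is_lim_seq_unique in L2.
  enough (E : Finite (Series (fun i => wt mu i * Series (fun j => wt mu j * H i j)))
    = Finite (Series (fun j => wt mu j * Series (fun i => wt mu i * H i j))))
    by (injection E; auto).
  rewrite <- L1, <- L2; apply Lim_seq_ext; intros N.
  assert (E : forall G : nat -> nat -> R,
    sum_n (fun i => wt mu i * sum_n (fun j => wt mu j * G i j) N) N
    = sum_n (fun i => sum_n (fun j => wt mu i * (wt mu j * G i j)) N) N).
  { intros G; apply sum_n_ext; intros i; symmetry; apply (sum_n_mult_l (wt mu i)). }
  rewrite !E, sum_n_swap; apply sum_n_ext; intros j; apply sum_n_ext; intros i.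
  rewrite <- !Rmult_assoc, (Rmult_comm (wt mu i)); reflexivity.
Qed.

Lemma mean1_swap {X : Type} (mu : dist X) (H : nat * bool -> nat * bool -> R) (M : R) :
  (forall z z', Rabs (H z z') <= M) ->
  mean1 mu (fun z => mean1 mu (H z)) = mean1 mu (fun z' => mean1 mu (fun z => H z z')).
Proof.
  intros HH.
  assert (E : forall G : nat * bool -> nat * bool -> R, (forall z z', Rabs (G z z') <= M) ->
    mean1 mu (fun z => mean1 mu (G z))
    = Series (fun i => wt mu i * Series (fun j => wt mu j *
        mix mu (fun z => mix mu (G z) j) i))).
  { intros G HG; apply Series_ext; intros i; f_equal.
    unfold mix at 1; unfold mean1; rewrite <- !Series_scal_l, <- Series_plus.
    - apply Series_ext; intros j; unfold mix; ring.
    - apply (ex_series_scal_l (cp mu i)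
        (fun j => wt mu j * mix mu (G (i, true)) j)), ex_series_wt with (M := M).
      intros; apply mix_abs; auto.
    - apply (ex_series_scal_l (1 - cp mu i)
        (fun j => wt mu j * mix mu (G (i, false)) j)), ex_series_wt with (M := M).
      intros; apply mix_abs; auto. }
  rewrite !E by auto.
  rewrite Series_wt_swap with (M := M).
  - apply Series_ext; intros j; f_equal; apply Series_ext; intros i; unfold mix; ring.
  - intros i j; apply mix_abs; intros z; apply mix_abs; auto.
Qed.

Lemma mean_ext {X : Type} (mu : dist X) (n : nat) (F G : list (nat * bool) -> R) :
  (forall s, length s = n -> F s = G s) -> mean mu n F = mean mu n G.
Proof.
  revert F G; induction n as [|n IH]; intros F G H; simpl; [apply H; reflexivity|].
  apply mean1_ext; intros z; apply IH; intros s Hs; apply H; simpl; congruence.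
Qed.

Lemma mean_const {X : Type} (mu : dist X) (n : nat) (c : R) : mean mu n (fun _ => c) = c.
Proof.
  induction n as [|n IH]; simpl; [reflexivity|].
  rewrite IH; apply mean1_const.
Qed.

Lemma mean_scal {X : Type} (mu : dist X) (n : nat) (c : R) (F : list (nat * bool) -> R) :
  mean mu n (fun s => c * F s) = c * mean mu n F.
Proof.
  revert F; induction n as [|n IH]; intros F; simpl; [reflexivity|].
  rewrite <- mean1_scal; apply mean1_ext; intros z; apply IH.
Qed.

Definition bdd (n : nat) (F : list (nat * bool) -> R) (M : R) : Prop :=
  forall s, length s = n -> Rabs (F s) <= M.

Lemma bdd_cons (n : nat) (F : list (nat * bool) -> R) (M : R) (z : nat * bool) :
  bdd (S n) F M -> bdd n (fun s => F (z :: s)) M.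
Proof. intros H s Hs; apply H; simpl; congruence. Qed.

Lemma mean_abs {X : Type} (mu : dist X) (n : nat) (F : list (nat * bool) -> R) (M : R) :
  bdd n F M -> Rabs (mean mu n F) <= M.
Proof.
  revert F; induction n as [|n IH]; intros F H; simpl; [apply H; reflexivity|].
  apply mean1_abs; intros z; apply IH, bdd_cons, H.
Qed.

Lemma mean_plus {X : Type} (mu : dist X) (n : nat) (F G : list (nat * bool) -> R) (M : R) :
  bdd n F M -> bdd n G M ->
  mean mu n (fun s => F s + G s) = mean mu n F + mean mu n G.
Proof.
  revert F G; induction n as [|n IH]; intros F G HF HG; simpl; [reflexivity|].
  rewrite <- (mean1_plus mu _ _ M) by (intros z; apply mean_abs, bdd_cons; assumption).
  apply mean1_ext; intros z; apply IH; apply bdd_cons; assumption.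
Qed.

Lemma mean_le {X : Type} (mu : dist X) (n : nat) (F G : list (nat * bool) -> R) (M : R) :
  bdd n F M -> bdd n G M ->
  (forall s, length s = n -> List.Forall (fun z => 0 < wt mu (fst z)) s -> F s <= G s) ->
  mean mu n F <= mean mu n G.
Proof.
  revert F G; induction n as [|n IH]; intros F G HF HG H; simpl;
    [apply H; [reflexivity|constructor]|].
  apply mean1_le with (M := M); try (intros z; apply mean_abs, bdd_cons; assumption).
  intros z Hz; apply IH; try (apply bdd_cons; assumption).
  intros s Hs Hf; apply H; [simpl; congruence|constructor; auto].
Qed.

Lemma mean_swap {X : Type} (mu : dist X) (n : nat)
  (H : nat * bool -> list (nat * bool) -> R) (M : R) :
  (forall z, bdd n (H z) M) ->
  mean1 mu (fun z => mean mu n (H z)) = mean mu n (fun s => mean1 mu (fun z => H z s)).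
Proof.
  revert H; induction n as [|n IH]; intros H HH; simpl; [reflexivity|].
  rewrite mean1_swap with (M := M)
    by (intros z z'; apply mean_abs; apply bdd_cons; apply HH).
  apply mean1_ext; intros z'; apply (IH (fun z s => H z (z' :: s))).
  intros z; apply bdd_cons, HH.
Qed.

(** * Splitting a sample into memorized and fresh coordinates *)

Definition nfalse (mask : list bool) : nat := length (filter negb mask).

(** Inverse of splitting a sample along [mask]: positions marked [true] are filled from [mem], the
    coordinates used by a description, and the others from [rest]. *)
Fixpoint weave {A : Type} (mask : list bool) (mem rest : list A) : list A :=
  match mask with
  | [] => []
  | true :: mk => match mem with [] => [] | a :: mem' => a :: weave mk mem' rest end
  | false :: mk => match rest with [] => [] | a :: rest' => a :: weave mk mem rest' end
  end.

Lemma weave_length {A : Type} (mask : list bool) (mem rest : list A) :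
  length mem = ntrue mask -> length rest = nfalse mask ->
  length (weave mask mem rest) = length mask.
Proof.
  unfold ntrue, nfalse; revert mem rest; induction mask as [|c mask IH];
    intros mem rest Hm Hr; simpl in *; auto.
  destruct c; simpl in *.
  - destruct mem; simpl in *; [discriminate Hm|rewrite IH; auto].
  - destruct rest; simpl in *; [discriminate Hr|rewrite IH; auto].
Qed.

Lemma mean_weave {X : Type} (mu : dist X) (mask : list bool)
  (F : list (nat * bool) -> R) (M : R) :
  bdd (length mask) F M ->
  mean mu (length mask) F
  = mean mu (ntrue mask) (fun mem => mean mu (nfalse mask)
      (fun rest => F (weave mask mem rest))).
Proof.
  unfold ntrue, nfalse; revert F; induction mask as [|c mask IH]; intros F HF; simpl;
    [reflexivity|].
  destruct c; simpl.
  - apply mean1_ext; intros z; apply IH, bdd_cons, HF.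
  - rewrite (mean1_ext _ _ _ (fun z => IH _ (bdd_cons _ _ _ z HF))).
    apply mean_swap with (M := M).
    intros z mem Hm; apply mean_abs; intros rest Hr; apply HF; simpl.
    rewrite weave_length; auto.
Qed.

Lemma weave_nth {A : Type} (mask : list bool) (mem rest rest' : list A) (i : nat) (a : A) :
  length mem = ntrue mask -> length rest = nfalse mask -> length rest' = nfalse mask ->
  nth i mask false = true ->
  nth i (weave mask mem rest) a = nth i (weave mask mem rest') a.
Proof.
  unfold ntrue, nfalse; revert mem rest rest' i; induction mask as [|c mask IH];
    intros mem rest rest' i Hm Hr Hr' Hi; simpl in *; auto.
  destruct c; simpl in *.
  - destruct mem; simpl in *; [discriminate Hm|]; destruct i as [|i]; auto.
  - destruct rest, rest'; simpl in *; try discriminate.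
    destruct i as [|i]; [discriminate Hi|auto].
Qed.

Definition rsum (l : list R) : R := fold_right Rplus 0 l.

Lemma rsum_abs {A : Type} (f : A -> R) (l : list A) (M : R) :
  (forall a, Rabs (f a) <= M) -> Rabs (rsum (map f l)) <= M * INR (length l).
Proof.
  intros H; induction l as [|a l IH]; simpl length.
  - simpl; rewrite Rabs_R0; lra.
  - rewrite S_INR; simpl; eapply Rle_trans; [apply Rabs_triang|]; specialize (H a); lra.
Qed.

Lemma rsum_weave {A : Type} (f : A -> R) (mask : list bool) (mem rest : list A) :
  length mem = ntrue mask -> length rest = nfalse mask ->
  rsum (map f (weave mask mem rest)) = rsum (map f mem) + rsum (map f rest).
Proof.
  unfold ntrue, nfalse; revert mem rest; induction mask as [|c mask IH];
    intros mem rest Hm Hr; simpl in *.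
  - destruct mem, rest; simpl in *; try discriminate; ring.
  - destruct c; simpl in *.
    + destruct mem; simpl in *; [discriminate Hm|]; rewrite IH by auto; ring.
    + destruct rest; simpl in *; [discriminate Hr|]; rewrite IH by auto; ring.
Qed.

(** * Exponential moments of sample-dependent sums *)

Lemma exp_le (u v : R) : u <= v -> exp u <= exp v.
Proof. intros H; destruct H as [H| ->]; [left; apply exp_increasing, H|apply Rle_refl]. Qed.

(** The inequality [1 + x <= exp x] at [x = - u / 2] gives [exp u <= / (1 - u / 2) ^ 2]. The rest is
    polynomial and reduces to [0 <= 1 - 3 * u + u ^ 2], which holds on this range. *)
Lemma exp_quadratic_bound (u : R) : Rabs u <= 1/4 -> exp u <= 1 + u + u ^ 2.
Proof.
  intros Hu; apply Rabs_le_between in Hu.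
  assert (H1 : 0 < 1 - u / 2) by lra.
  assert (H2 : exp (u / 2) * (1 - u / 2) <= 1).
  { pose proof (exp_ineq1_le (- (u / 2))) as H.
    pose proof (exp_pos (u / 2)).
    assert (E : exp (u / 2) * exp (- (u / 2)) = 1)
      by (rewrite <- exp_plus, Rplus_opp_r; apply exp_0).
    nra. }
  assert (H3 : exp u * (1 - u / 2) ^ 2 <= 1).
  { replace u with (u / 2 + u / 2) at 1 by field; rewrite exp_plus.
    pose proof (exp_pos (u / 2)).
    replace (_ * _) with ((exp (u / 2) * (1 - u / 2)) ^ 2) by ring.
    assert (0 <= exp (u / 2) * (1 - u / 2)) by (apply Rmult_le_pos; lra).
    nra. }
  assert (H4 : 1 <= (1 + u + u ^ 2) * (1 - u / 2) ^ 2).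
  { replace ((1 + u + u ^ 2) * (1 - u / 2) ^ 2)
      with (1 + u ^ 2 / 4 * (1 - 3 * u + u ^ 2)) by field. nra. }
  assert (H5 : 0 < (1 - u / 2) ^ 2) by nra.
  apply Rmult_le_reg_r with ((1 - u / 2) ^ 2); lra.
Qed.

(** The linear term of the quadratic bound averages to zero because [psi] is centred. *)
Lemma mean1_exp {X : Type} (mu : dist X) (psi : nat * bool -> R) (lam c : R) :
  0 <= lam -> lam * c <= 1/4 -> (forall z, Rabs (psi z) <= c) -> mean1 mu psi = 0 ->
  mean1 mu (fun z => exp (lam * psi z)) <= exp ((lam * c) ^ 2).
Proof.
  intros Hl Hlc Hpsi H0.
  assert (Hu : forall z, Rabs (lam * psi z) <= lam * c).
  { intros z; rewrite Rabs_mult, (Rabs_pos_eq lam) by auto.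
    apply Rmult_le_compat_l; auto. }
  assert (Hlc0 : 0 <= lam * c)
    by (eapply Rle_trans; [apply Rabs_pos|apply (Hu (0%nat, true))]).
  eapply Rle_trans; [|apply exp_ineq1_le].
  replace (1 + (lam * c) ^ 2)
    with (mean1 mu (fun z => (1 + (lam * c) ^ 2) + lam * psi z)).
  - apply mean1_le with (M := 3).
    + intros z; rewrite Rabs_pos_eq by (left; apply exp_pos).
      pose proof (exp_quadratic_bound _ (Rle_trans _ _ _ (Hu z) Hlc)).
      specialize (Hu z); apply Rabs_le_between in Hu; nra.
    + intros z; specialize (Hu z); apply Rabs_le_between in Hu; apply Rabs_le; nra.
    + intros z _; pose proof (exp_quadratic_bound _ (Rle_trans _ _ _ (Hu z) Hlc)).
      specialize (Hu z); apply Rabs_le_between in Hu; nra.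
  - rewrite mean1_plus with (M := 2).
    + rewrite mean1_const, mean1_scal, H0; ring.
    + intros _; rewrite Rabs_pos_eq; nra.
    + intros z; specialize (Hu z); lra.
Qed.

Lemma mean_exp {X : Type} (mu : dist X) (psi : nat * bool -> R) (lam c : R) (n : nat) :
  0 <= lam -> lam * c <= 1/4 -> (forall z, Rabs (psi z) <= c) -> mean1 mu psi = 0 ->
  mean mu n (fun s => exp (lam * rsum (map psi s))) <= exp ((lam * c) ^ 2 * INR n).
Proof.
  intros Hl Hlc Hpsi H0; induction n as [|n IH].
  - simpl; rewrite !Rmult_0_r; lra.
  - rewrite S_INR, Rmult_plus_distr_l, Rmult_1_r, exp_plus; simpl mean.
    rewrite (mean1_ext _ _ (fun z =>
      mean mu n (fun s => exp (lam * rsum (map psi s))) * exp (lam * psi z))).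
    + rewrite mean1_scal; apply Rmult_le_compat; auto.
      * rewrite <- (mean_const mu n 0).
        apply mean_le with (M := exp (lam * (c * INR n))).
        -- intros s _; rewrite Rabs_R0; left; apply exp_pos.
        -- intros s Hs; rewrite Rabs_pos_eq by (left; apply exp_pos).
           apply exp_le, Rmult_le_compat_l; auto.
           rewrite <- Hs; apply Rabs_le_between, (rsum_abs psi s c Hpsi).
        -- intros; left; apply exp_pos.
      * rewrite <- (mean1_const mu 0); apply mean1_le with (M := exp (lam * c)).
        -- intros _; rewrite Rabs_R0; left; apply exp_pos.
        -- intros z; rewrite Rabs_pos_eq by (left; apply exp_pos).
           apply exp_le, Rmult_le_compat_l; auto.
           specialize (Hpsi z); apply Rabs_le_between in Hpsi; lra.
        -- intros; left; apply exp_pos.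
      * apply mean1_exp; auto.
    + intros z; rewrite Rmult_comm, <- mean_scal; apply mean_ext; intros s _.
      simpl; rewrite <- exp_plus; f_equal; ring.
Qed.

(* The coordinates in [I] fix the function [Psi s]; by [mean_weave] the
   remaining ones are an independent sample to be averaged first. *)
Lemma compression_exp_moment {X : Type} (mu : dist X) (n : nat) (I : list nat)
  (Psi : list (nat * bool) -> nat * bool -> R) (lam c : R) :
  0 <= lam -> lam * c <= 1/4 ->
  (forall s z, Rabs (Psi s z) <= c) ->
  (forall s, mean1 mu (Psi s) = 0) ->
  (forall s s', length s = n -> length s' = n ->
     (forall i, In i I -> (i < n)%nat -> nth i s (0%nat, true) = nth i s' (0%nat, true)) ->
     forall z, Psi s z = Psi s' z) ->
  mean mu n (fun s => exp (lam * rsum (map (Psi s) s)))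
  <= exp (lam * c * INR (length I) + (lam * c) ^ 2 * INR n).
Proof.
  intros Hl Hlc Hb H0 Hdep.
  assert (Hc : 0 <= c) by (eapply Rle_trans; [apply Rabs_pos|apply (Hb [] (0%nat, true))]).
  (* Marks the coordinates of the sample listed in [I]; repetitions and indices beyond [n] can only
     make [ntrue mask] smaller than [length I]. *)
  set (mask := map (fun i => existsb (Nat.eqb i) I) (seq 0 n)).
  assert (Hlen : length mask = n) by (unfold mask; rewrite length_map, length_seq; auto).
  assert (Hnt : (ntrue mask <= length I)%nat).
  { unfold ntrue, mask; rewrite filter_map_length.
    apply NoDup_incl_length; [apply NoDup_filter, seq_NoDup|].
    intros i Hi; apply filter_In in Hi; destruct Hi as [_ Hi].
    apply existsb_exists in Hi; destruct Hi as [j [Hj E]].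
    apply Nat.eqb_eq in E; rewrite E; auto. }
  assert (Hnf : (nfalse mask <= n)%nat).
  { eapply Nat.le_trans; [apply filter_length_le|rewrite Hlen; auto]. }
  assert (Hmask : forall i, In i I -> (i < n)%nat -> nth i mask false = true).
  { intros i Hi Hin; unfold mask; erewrite nth_indep by (rewrite length_map, length_seq; auto).
    rewrite (map_nth (fun i => existsb (Nat.eqb i) I) _ 0%nat), seq_nth by auto.
    apply existsb_exists; exists i; split; auto; apply Nat.eqb_refl. }
  set (bound := exp (lam * (c * INR n))).
  assert (Hbdd : bdd n (fun s => exp (lam * rsum (map (Psi s) s))) bound).
  { intros s Hs; rewrite Rabs_pos_eq by (left; apply exp_pos).
    apply exp_le, Rmult_le_compat_l; auto.
    rewrite <- Hs; apply Rabs_le_between, (rsum_abs (Psi s) s c (Hb s)). }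
  pose proof (mean_weave mu mask (fun s => exp (lam * rsum (map (Psi s) s))) bound) as HW.
  rewrite Hlen in HW; rewrite (HW Hbdd).
  rewrite <- (mean_const mu (ntrue mask)
    (exp (lam * c * INR (length I) + (lam * c) ^ 2 * INR n))).
  apply mean_le with
    (M := Rmax bound (exp (lam * c * INR (length I) + (lam * c) ^ 2 * INR n))).
  - intros mem Hm; apply mean_abs; intros rest Hr; eapply Rle_trans; [|apply Rmax_l].
    apply Hbdd; rewrite weave_length; auto.
  - intros mem Hm; rewrite Rabs_pos_eq by (left; apply exp_pos); apply Rmax_r.
  - intros mem Hm _.
    (* Only marked coordinates influence [Psi], so a constant filler fixes [psi] before [rest] is
       averaged. *)
    set (psi := Psi (weave mask mem (repeat (0%nat, true) (nfalse mask)))).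
    rewrite (mean_ext _ _ _ (fun rest =>
      exp (lam * rsum (map psi mem)) * exp (lam * rsum (map psi rest)))).
    + rewrite mean_scal, exp_plus.
      apply Rmult_le_compat; try (left; apply exp_pos).
      * rewrite <- (mean_const mu (nfalse mask) 0).
        apply mean_le with (M := exp (lam * (c * INR (nfalse mask)))).
        -- intros s _; rewrite Rabs_R0; left; apply exp_pos.
        -- intros s Hs; rewrite Rabs_pos_eq by (left; apply exp_pos).
           apply exp_le, Rmult_le_compat_l; auto.
           rewrite <- Hs; apply Rabs_le_between, (rsum_abs psi s c (Hb _)).
        -- intros; left; apply exp_pos.
      (* The memorized examples are not independent of [psi], so each is bounded by its worst value
         [c]; this is the cost of compression. *)
      * apply exp_le; rewrite Rmult_assoc; apply Rmult_le_compat_l; auto.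
        apply Rle_trans with (c * INR (length mem)).
        -- apply Rabs_le_between, (rsum_abs psi mem c (Hb _)).
        -- apply Rmult_le_compat_l; auto; rewrite Hm; apply le_INR; auto.
      * eapply Rle_trans; [apply mean_exp with (c := c)|]; auto; [apply Hb|apply H0|].
        apply exp_le, Rmult_le_compat_l; [apply pow2_ge_0|apply le_INR; auto].
    + intros rest Hr; rewrite <- exp_plus, <- Rmult_plus_distr_l.
      rewrite <- rsum_weave with (mask := mask) by auto.
      do 3 f_equal; apply map_ext; intros z; apply Hdep.
      * rewrite weave_length; auto.
      * rewrite weave_length; auto; apply repeat_length.
      * intros i Hi Hin; apply weave_nth; auto; apply repeat_length.
Qed.

(** * Predictors assembled from the cells of a grid *)

Fixpoint psum (n : nat) (F : nat -> R) : R :=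
  match n with O => 0 | S n' => psum n' F + F n' end.

Lemma psum_le (n : nat) (F G : nat -> R) :
  (forall j, (j < n)%nat -> F j <= G j) -> psum n F <= psum n G.
Proof.
  induction n as [|n IH]; intros H; simpl; [lra|].
  apply Rplus_le_compat; [apply IH; intros; apply H; lia|apply H; lia].
Qed.

Lemma psum_ext (n : nat) (F G : nat -> R) :
  (forall j, (j < n)%nat -> F j = G j) -> psum n F = psum n G.
Proof.
  intros H; apply Rle_antisym; apply psum_le; intros j Hj; rewrite H; auto; lra.
Qed.

Lemma psum_plus (n : nat) (F G : nat -> R) :
  psum n (fun j => F j + G j) = psum n F + psum n G.
Proof. induction n as [|n IH]; simpl; [ring|rewrite IH; ring]. Qed.

Lemma psum_scal (n : nat) (c : R) (F : nat -> R) :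
  psum n (fun j => c * F j) = c * psum n F.
Proof. induction n as [|n IH]; simpl; [ring|rewrite IH; ring]. Qed.

Lemma psum_const (n : nat) (c : R) : psum n (fun _ => c) = INR n * c.
Proof. induction n as [|n IH]; [simpl; ring|rewrite S_INR; simpl psum; rewrite IH; ring]. Qed.

Lemma count_below_last (n : nat) (p : nat -> bool) :
  count_below (S n) p = (count_below n p + Nat.b2n (p n))%nat.
Proof.
  unfold count_below; rewrite seq_S, filter_app, length_app; simpl.
  destruct (p n); reflexivity.
Qed.

Lemma count_below_le (n : nat) (p : nat -> bool) : (count_below n p <= n)%nat.
Proof.
  unfold count_below; rewrite <- (length_seq n 0) at 2; apply filter_length_le.
Qed.

Lemma INR_count_below (n : nat) (p : nat -> bool) :
  INR (count_below n p) = psum n (fun j => if p j then 1 else 0).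
Proof.
  induction n as [|n IH]; [reflexivity|].
  rewrite count_below_last, plus_INR, IH; simpl; destruct (p n); reflexivity.
Qed.

(** Increments of a convex function are sorted, so moving the chosen cells to the bottom of the grid
    can only lower their sum. This lets a bare count replace the set of cells answered
    affirmatively. *)
Lemma psum_smallest (n : nat) (D : nat -> R) (u : nat -> bool) :
  (forall i j, (i <= j < n)%nat -> D i <= D j) ->
  psum (count_below n u) D <= psum n (fun j => if u j then D j else 0).
Proof.
  induction n as [|n IH]; intros HD; [simpl; lra|].
  rewrite count_below_last; simpl.
  assert (H : psum (count_below n u) D <= psum n (fun j => if u j then D j else 0))
    by (apply IH; intros; apply HD; lia).
  destruct (u n); simpl.
  - rewrite Nat.add_1_r; simpl; apply Rplus_le_compat; auto.
    apply HD; pose proof (count_below_le n u); lia.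
  - rewrite Nat.add_0_r; lra.
Qed.

Definition grid (g : R) (j : nat) : R := -1 + g * INR j.

Lemma grid_S (g : R) (j : nat) : grid g (S j) = grid g j + g.
Proof. unfold grid; rewrite S_INR; ring. Qed.

Definition increment (phi : R -> R) (g : R) (j : nat) : R :=
  phi (grid g (S j)) - phi (grid g j).

Lemma increment_telescope (phi : R -> R) (g : R) (n : nat) :
  phi (grid g n) = phi (-1) + psum n (increment phi g).
Proof.
  induction n as [|n IH]; simpl psum.
  - unfold grid; simpl; replace (-1 + g * 0) with (-1) by ring; ring.
  - unfold increment at 2; rewrite <- Rplus_assoc, <- IH; ring.
Qed.

Lemma grid_range (G j : nat) :
  (0 < G)%nat -> (j <= G)%nat -> -1 <= grid (2 / INR G) j <= 1.
Proof.
  intros HG Hj; unfold grid; apply lt_INR in HG; simpl in HG; apply le_INR in Hj.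
  pose proof (pos_INR j).
  assert (0 <= 2 / INR G * INR j <= 2); [|lra].
  replace (2 / INR G * INR j) with (2 * (INR j / INR G)) by (field; lra).
  assert (0 <= INR j / INR G) by (apply Rdiv_le_0_compat; lra).
  assert (INR j / INR G <= 1) by (apply Rle_div_l; lra).
  lra.
Qed.

Definition convex_on_interval (phi : R -> R) : Prop :=
  forall a c t, -1 <= a <= 1 -> -1 <= c <= 1 -> 0 <= t <= 1 ->
    phi (t * a + (1 - t) * c) <= t * phi a + (1 - t) * phi c.

Definition nonexpansive_on_interval (phi : R -> R) : Prop :=
  forall a c, -1 <= a <= 1 -> -1 <= c <= 1 -> Rabs (phi a - phi c) <= Rabs (a - c).

Lemma increment_mono (phi : R -> R) (G : nat) :
  convex_on_interval phi -> (0 < G)%nat ->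
  forall i j, (i <= j < G)%nat ->
    increment phi (2 / INR G) i <= increment phi (2 / INR G) j.
Proof.
  intros Hphi HG i j [Hij Hj]; induction Hij as [|j Hij IH]; [lra|].
  eapply Rle_trans; [apply IH; lia|].
  unfold increment.
  pose proof (Hphi (grid (2 / INR G) j) (grid (2 / INR G) (S (S j))) (1/2)
    (grid_range G j HG ltac:(lia)) (grid_range G (S (S j)) HG ltac:(lia)) ltac:(lra)) as H.
  replace (1 / 2 * _ + (1 - 1 / 2) * grid (2 / INR G) (S (S j)))
    with (grid (2 / INR G) (S j)) in H by (rewrite !grid_S; field;
      apply not_0_INR; lia).
  lra.
Qed.

Lemma increment_abs (phi : R -> R) (G j : nat) :
  nonexpansive_on_interval phi -> (j < G)%nat ->
  Rabs (increment phi (2 / INR G) j) <= 2 / INR G.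
Proof.
  intros Hphi Hj.
  assert (0 < INR G) by (apply lt_0_INR; lia).
  assert (0 < 2 / INR G) by (apply Rdiv_lt_0_compat; lra).
  eapply Rle_trans; [apply Hphi; apply grid_range; lia|].
  rewrite grid_S.
  replace (grid (2 / INR G) j + 2 / INR G - grid (2 / INR G) j) with (2 / INR G) by ring.
  rewrite Rabs_pos_eq; lra.
Qed.

Definition above_grid (g b : R) (j : nat) : bool :=
  if Rlt_dec (grid g j) b then true else false.

(** The cells starting below [b] form an initial segment, so the sum telescopes to [phi] at the
    first grid point not below [b], at distance less than one cell from [b]. *)
Lemma grid_rounding (phi : R -> R) (G : nat) (b : R) :
  nonexpansive_on_interval phi -> (0 < G)%nat -> -1 <= b <= 1 ->
  phi (-1) + psum G (fun j =>
    if above_grid (2 / INR G) b j then increment phi (2 / INR G) j else 0)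
  <= phi b + 2 / INR G.
Proof.
  intros Hphi HG Hb; set (g := 2 / INR G).
  assert (HG' : 0 < INR G) by (apply lt_0_INR; lia).
  assert (Hg : 0 < g) by (apply Rdiv_lt_0_compat; lra).
  assert (Hmono : forall i j, (i <= j)%nat -> grid g i <= grid g j).
  { intros i j Hij; apply le_INR in Hij; unfold grid; nra. }
  assert (H : forall n, exists i, (i <= n)%nat /\
    phi (-1) + psum n (fun j => if above_grid g b j then increment phi g j else 0)
    = phi (grid g i) /\ grid g i < b + g /\ (i = n \/ b <= grid g i)).
  { induction n as [|n IH].
    - exists 0%nat; unfold grid; simpl.
      replace (-1 + g * 0) with (-1) by ring; repeat split; auto; [ring|lra].
    - destruct IH as [i [Hi [E [Hlt Hcase]]]]; simpl psum; unfold above_grid at 2.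
      destruct (Rlt_dec (grid g n) b) as [Hn|Hn].
      + assert (i = n).
        { destruct Hcase as [|Hge]; auto; specialize (Hmono i n Hi); lra. }
        subst i; exists (S n); rewrite <- Rplus_assoc, E, grid_S.
        repeat split; auto; [|lra].
        unfold increment; rewrite grid_S; ring.
      + exists i; rewrite Rplus_0_r; repeat split; auto; right.
        destruct Hcase as [->|]; lra. }
  destruct (H G) as [i [Hi [-> [Hlt Hcase]]]].
  assert (Hge : b <= grid g i).
  { destruct Hcase as [->|]; auto; unfold grid, g.
    replace (-1 + 2 / INR G * INR G) with 1 by (field; lra); lra. }
  pose proof (Hphi b (grid g i) Hb (grid_range G i HG Hi)) as HL.
  rewrite (Rabs_left1 (b - _)) in HL by lra; apply Rabs_le_between in HL; lra.
Qed.

Definition near_grid (g eta b : R) (j : nat) : bool :=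
  if Rle_dec (Rabs (b - grid g j)) eta then true else false.

(* Each grid point within [eta] of [b] starts a cell of length [g] inside
   [[b - eta, b + eta + g]]; the clamp measures the part of that interval
   already swept. *)
Lemma near_grid_measure (g eta b : R) (n : nat) :
  0 <= g -> 0 <= eta ->
  psum n (fun j => if near_grid g eta b j then g else 0) <= 2 * eta + g.
Proof.
  intros Hg He.
  set (clamp := fun t => Rmax 0 (Rmin (t - (b - eta)) (2 * eta + g))).
  assert (Hc : forall t, 0 <= clamp t <= 2 * eta + g).
  { intros t; unfold clamp; split; [apply Rmax_l|].
    apply Rmax_lub; [lra|apply Rmin_r]. }
  enough (H : psum n (fun j => if near_grid g eta b j then g else 0)
              <= clamp (grid g n) - clamp (grid g 0)).
  { pose proof (Hc (grid g n)); pose proof (Hc (grid g 0)); lra. }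
  induction n as [|n IH]; [simpl; lra|]; simpl psum.
  enough ((if near_grid g eta b n then g else 0)
          <= clamp (grid g (S n)) - clamp (grid g n)) by lra.
  rewrite grid_S; unfold near_grid, clamp.
  destruct (Rle_dec _ _) as [H|H].
  - apply Rabs_le_between in H.
    rewrite !Rmin_left by lra; rewrite !Rmax_right by lra; lra.
  - enough (Rmax 0 (Rmin (grid g n - (b - eta)) (2 * eta + g))
      <= Rmax 0 (Rmin (grid g n + g - (b - eta)) (2 * eta + g))) by lra.
    apply Rle_max_compat_l, Rle_min_compat_r; lra.
Qed.

(** The steps taken by [u] are compared with those of [above_grid], the steps of [b] rounded to the
    grid. Margins [eta1] over cells of total length 2 give [2 * eta1]; cells near [b] give
    [2 * eta2] plus one cell; rounding gives another cell; an erroneous cell costs at most its own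
    length. *)
Lemma grid_prediction_loss (phi : R -> R) (G : nat) (eta1 eta2 b : R)
  (u err : nat -> bool) :
  convex_on_interval phi -> nonexpansive_on_interval phi ->
  (0 < G)%nat -> 0 <= eta1 -> 0 <= eta2 -> -1 <= b <= 1 ->
  (forall j, (j < G)%nat -> err j = false ->
     increment phi (2 / INR G) j < - (eta1 * (2 / INR G)) ->
     grid (2 / INR G) j + eta2 < b -> u j = true) ->
  (forall j, (j < G)%nat -> err j = false ->
     eta1 * (2 / INR G) < increment phi (2 / INR G) j ->
     b < grid (2 / INR G) j - eta2 -> u j = false) ->
  phi (grid (2 / INR G) (count_below G u)) - phi b
  <= 2 * eta1 + 2 * eta2 + 2 * (2 / INR G) + 2 / INR G * INR (count_below G err).
Proof.
  intros Hcv Hne HG He1 He2 Hb Hup Hdn; set (g := 2 / INR G) in *.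
  assert (HG' : 0 < INR G) by (apply lt_0_INR; lia).
  assert (Hg : 0 < g) by (apply Rdiv_lt_0_compat; lra).
  rewrite increment_telescope.
  pose proof (psum_smallest G (increment phi g) u (increment_mono phi G Hcv HG)) as H1.
  pose proof (grid_rounding phi G b Hne HG Hb) as H2; fold g in H2.
  pose proof (near_grid_measure g eta2 b G ltac:(lra) He2) as H3.
  (* On a correct cell away from [b], a choice that differs from that of [b] loses at most
     [g * eta1]: a larger loss would put the cell under [Hup] or [Hdn]. *)
  assert (H4 : psum G (fun j => if u j then increment phi g j else 0)
    <= psum G (fun j => (if above_grid g b j then increment phi g j else 0)
       + (g * eta1 + ((if near_grid g eta2 b j then g else 0)
                      + g * (if err j then 1 else 0))))).
  { apply psum_le; intros j Hj.
    pose proof (increment_abs phi G j Hne Hj) as HD; fold g in HD.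
    apply Rabs_le_between in HD.
    specialize (Hup j Hj); specialize (Hdn j Hj).
    assert (0 <= g * eta1) by nra.
    destruct (err j).
    { destruct (u j), (above_grid g b j), (near_grid g eta2 b j); lra. }
    specialize (Hup eq_refl); specialize (Hdn eq_refl).
    unfold near_grid; destruct (Rle_dec (Rabs (b - grid g j)) eta2) as [|Hfar].
    { destruct (u j), (above_grid g b j); lra. }
    unfold above_grid; destruct (Rlt_dec (grid g j) b) as [Hab|Hab].
    - rewrite Rabs_pos_eq in Hfar by lra.
      destruct (u j); [lra|].
      destruct (Rlt_dec (increment phi g j) (- (eta1 * g))) as [Hi|Hi]; [|lra].
      discriminate (Hup Hi ltac:(lra)).
    - rewrite Rabs_left1 in Hfar by lra.
      destruct (u j); [|lra].
      destruct (Rlt_dec (eta1 * g) (increment phi g j)) as [Hi|Hi]; [|lra].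
      discriminate (Hdn Hi ltac:(lra)). }
  rewrite !psum_plus, psum_const, psum_scal, <- INR_count_below in H4.
  assert (E : INR G * (g * eta1) = 2 * eta1) by (unfold g; field; lra).
  lra.
Qed.

(* [slope_side A B] is a threshold [r] and a direction such that the sign of
   [A + q * B] is negative on one side of [r] and positive on the other; when
   [B = 0] the threshold lies outside [[-1, 1]] and the margins. *)
Definition slope_side (A B : R) : R * bool :=
  if Rlt_dec B 0 then (- A / B, true)
  else if Rlt_dec 0 B then (- A / B, false)
  else if Rlt_dec A 0 then (-2, true) else (2, true).

(** With [r = - A / B] the increment is [B * (q - r)], and [Rabs B <= g] turns an increment of size
    above [eta * g] into a distance above [eta] between [q] and [r]. If [B = 0], the threshold -2 or
    2 is beyond the margin of every [q], as [eta < 1/2]. *)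
Lemma slope_side_neg (A B g eta q : R) :
  0 <= eta < 1/2 -> Rabs B <= g -> -1 <= q <= 1 -> A + q * B < - (eta * g) ->
  if snd (slope_side A B) then fst (slope_side A B) + eta < q
  else q < fst (slope_side A B) - eta.
Proof.
  intros He HB Hq H; apply Rabs_le_between in HB; unfold slope_side.
  destruct (Rlt_dec B 0); [|destruct (Rlt_dec 0 B); [|destruct (Rlt_dec A 0)]]; simpl.
  - replace A with (- B * (- A / B)) in H by (field; lra).
    set (w := - A / B) in *; nra.
  - replace A with (- B * (- A / B)) in H by (field; lra).
    set (w := - A / B) in *; nra.
  - lra.
  - replace B with 0 in * by lra; nra.
Qed.

Lemma slope_side_pos (A B g eta q : R) :
  0 <= eta < 1/2 -> Rabs B <= g -> -1 <= q <= 1 -> eta * g < A + q * B ->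
  if snd (slope_side A B) then q < fst (slope_side A B) - eta
  else fst (slope_side A B) + eta < q.
Proof.
  intros He HB Hq H; apply Rabs_le_between in HB; unfold slope_side.
  destruct (Rlt_dec B 0); [|destruct (Rlt_dec 0 B); [|destruct (Rlt_dec A 0)]]; simpl.
  - replace A with (- B * (- A / B)) in H by (field; lra).
    set (w := - A / B) in *; nra.
  - replace A with (- B * (- A / B)) in H by (field; lra).
    set (w := - A / B) in *; nra.
  - replace B with 0 in * by lra; nra.
  - lra.
Qed.

(** The label is taken from [h2], so [Some true] always means stepping up. The flag [dir] is [true]
    when the loss decreases for [q] above the threshold behind [h1]; for the other direction [h1]
    has to be read reversed. *)
Definition agreement {X : Type} (dir : bool) (h1 h2 : X -> option bool) (x : X)
  : option bool :=
  match h1 x, h2 x with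
  | Some a, Some c => if eqb a (eqb c dir) then Some c else None
  | _, _ => None
  end.

Definition agreement_class {X : Type} (dir : bool) (H1 H2 : (X -> option bool) -> Prop)
  : (X -> option bool) -> Prop :=
  fun k => exists h1 h2, H1 h1 /\ H2 h2 /\ k = agreement dir h1 h2.

(* A set shattered by the agreement class is shattered by both classes, up to
   reversing all labels when [dir = false]. *)
Lemma agreement_class_VC {X : Type} (dir : bool) (H1 H2 : (X -> option bool) -> Prop)
  (d : nat) : VC2_le H1 H2 d -> VC_le (agreement_class dir H1 H2) d.
Proof.
  intros HVC xs Hnd Hsh; apply HVC; auto; intros xi.
  - destruct (Hsh (fun i => eqb (xi i) dir)) as [k [[h1 [h2 [Hh1 [Hh2 ->]]]] Hk]].
    exists h1; split; auto; intros i x Hi; specialize (Hk i x Hi).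
    unfold agreement in Hk; destruct (h1 x) as [a|], (h2 x) as [c|]; try discriminate Hk.
    destruct (eqb a (eqb c dir)) eqn:E; [|discriminate Hk].
    injection Hk as ->; f_equal; destruct a, (xi i), dir; auto; discriminate E.
  - destruct (Hsh xi) as [k [[h1 [h2 [Hh1 [Hh2 ->]]]] Hk]].
    exists h2; split; auto; intros i x Hi; specialize (Hk i x Hi).
    unfold agreement in Hk; destruct (h1 x) as [a|], (h2 x) as [c|]; try discriminate Hk.
    destruct (eqb a (eqb c dir)); [exact Hk|discriminate Hk].
Qed.

(** * Conditional losses and predictors described by sample points *)

Definition cond_loss (loss : R -> R -> R) (q a : R) : R :=
  (1 + q) / 2 * loss 1 a + (1 - q) / 2 * loss (-1) a.

Definition slope_parts (loss : R -> R -> R) (g : R) (j : nat) : R * R :=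
  let dp := increment (loss 1) g j in
  let dn := increment (loss (-1)) g j in
  ((dp + dn) / 2, (dp - dn) / 2).

Lemma increment_cond_loss (loss : R -> R -> R) (g q : R) (j : nat) :
  increment (cond_loss loss q) g j
  = fst (slope_parts loss g j) + q * snd (slope_parts loss g j).
Proof. unfold increment, cond_loss, slope_parts, increment; simpl; field. Qed.

Definition cell_class {X : Type} (S : (X -> option R) -> Prop) (B : (X -> R) -> Prop)
  (loss : R -> R -> R) (eta1 eta2 g : R) (j : nat) : (X -> option bool) -> Prop :=
  let side := slope_side (fst (slope_parts loss g j)) (snd (slope_parts loss g j)) in
  agreement_class (snd side) (thr_class S (fun _ => fst side) eta1)
    (thr_class (total_as_partial B) (fun _ => grid g j) eta2).

(** The memory of a predictor is a concatenation of blocks of length [t]; block [j] trains the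
    learner of cell [j]. *)
Definition chunk {A : Type} (t j : nat) (l : list A) : list A :=
  firstn t (skipn (j * t) l).

Definition reconstruct {X : Type} (A : nat -> list (X * option bool) -> X -> bool)
  (G t : nat) (mem : list (X * option bool)) (x : X) : R :=
  grid (2 / INR G) (count_below G (fun j => A j (chunk t j mem) x)).

Lemma chunk_flat_map {A : Type} (f : nat -> list A) (t n a j : nat) :
  (forall i, length (f i) = t) -> (j < n)%nat ->
  chunk t j (flat_map f (seq a n)) = f (a + j)%nat.
Proof.
  intros Hf; unfold chunk; revert a j; induction n as [|n IH]; intros a j Hj; [lia|].
  simpl flat_map; destruct j as [|j].
  - simpl; rewrite Nat.add_0_r, firstn_app, Hf, Nat.sub_diag, firstn_O, app_nil_r.
    rewrite <- (Hf a) at 1; apply firstn_all.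
  - rewrite skipn_app, Hf, skipn_all2 by (rewrite Hf; simpl; lia).
    replace (S j * t - t)%nat with (j * t)%nat by (simpl; lia).
    simpl app; rewrite IH by lia; f_equal; lia.
Qed.

Lemma indices_of {X L : Type} (pts : list X) (x0 : X) (mem : list (X * L)) :
  (forall p, In p mem -> In (fst p) pts) ->
  exists desc : list (nat * L), length desc = length mem /\
    (forall p, In p desc -> (fst p < length pts)%nat) /\
    map (fun p => (nth (fst p) pts x0, snd p)) desc = mem.
Proof.
  induction mem as [|[x c] mem IH]; intros H.
  - exists []; simpl; repeat split; auto; intros p [].
  - destruct IH as [desc [H1 [H2 H3]]]; [intros; apply H; right; auto|].
    destruct (In_nth pts x x0 (H (x, c) (or_introl eq_refl))) as [i [Hi Ei]].
    exists ((i, c) :: desc); simpl; rewrite H1, H3, Ei; repeat split; auto.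
    intros p [<-|Hp]; auto.
Qed.

Definition defined_value {X : Type} (s : X -> option R) (x : X) : R :=
  match s x with Some v => v | None => 0 end.

Lemma rsum_count_swap {X : Type} (pts : list X) (G : nat) (err : nat -> X -> bool) :
  rsum (map (fun x => INR (count_below G (fun j => err j x))) pts)
  = psum G (fun j => INR (length (filter (err j) pts))).
Proof.
  induction pts as [|a pts IH].
  - simpl; rewrite psum_const; ring.
  - simpl rsum; fold rsum; rewrite IH, INR_count_below, <- psum_plus.
    apply psum_ext; intros j _; simpl; destruct (err j a); simpl length;
      [rewrite S_INR|]; ring.
Qed.

Lemma rsum_affine_le {A : Type} (f h : A -> R) (c g : R) (l : list A) :
  (forall a, In a l -> f a <= c + g * h a) ->
  rsum (map f l) <= INR (length l) * c + g * rsum (map h l).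
Proof.
  induction l as [|a l IH]; intros H; [simpl; lra|].
  simpl length; rewrite S_INR; simpl.
  pose proof (H a (or_introl eq_refl)).
  assert (rsum (map f l) <= INR (length l) * c + g * rsum (map h l))
    by (apply IH; intros; apply H; right; auto).
  unfold rsum in *; lra.
Qed.

Definition cell_predictor {X : Type} (S : (X -> option R) -> Prop)
  (B : (X -> R) -> Prop) (loss : R -> R -> R) (eta1 eta2 : R) (m G : nat)
  : nat -> list (X * option bool) -> X -> bool :=
  fun j => one_inclusion (cell_class S B loss eta1 eta2 (2 / INR G) j) m.

(** Each cell gets its own short training sequence, labelled by the agreement of [s] and [b]. These
    labels are not computable from the sample, so they are recorded beside the indices. The loss
    bounded here is the conditional one, at the true values of [s]; observed labels do not enter. *)
Lemma short_description {X : Type} (S : (X -> option R) -> Prop) (B : (X -> R) -> Prop)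
  (loss : R -> R -> R) (eta1 eta2 : R) (m G t : nat) (s : X -> option R) (b : X -> R)
  (pts : list X) (x0 : X) :
  (forall y, y = 1 \/ y = -1 -> convex_on_interval (loss y)) ->
  (forall y, y = 1 \/ y = -1 -> nonexpansive_on_interval (loss y)) ->
  0 <= eta1 < 1/2 -> 0 <= eta2 -> supVC_le S B eta1 eta2 m -> (0 < G)%nat ->
  S s -> B b -> (forall x, -1 <= b x <= 1) ->
  (forall x, In x pts -> exists v, s x = Some v /\ -1 <= v <= 1) -> pts <> [] ->
  exists desc : list (nat * option bool), length desc = (G * t)%nat /\
    (forall p, In p desc -> (fst p < length pts)%nat) /\
    let f := reconstruct (cell_predictor S B loss eta1 eta2 m G) G t
               (map (fun p => (nth (fst p) pts x0, snd p)) desc) in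
    rsum (map (fun x => cond_loss loss (defined_value s x) (f x)
                        - cond_loss loss (defined_value s x) (b x)) pts)
    <= INR (length pts) * (2 * eta1 + 2 * eta2 + 2 * (2 / INR G)
                           + 4 * INR m / INR (Datatypes.S t)).
Proof.
  intros Hcv Hne He1 He2 HVC HG Hs Hb Hbr Hdef Hpts.
  set (g := 2 / INR G).
  assert (HG' : 0 < INR G) by (apply lt_0_INR; lia).
  assert (Hg : 0 < g) by (apply Rdiv_lt_0_compat; lra).
  set (side := fun j => slope_side (fst (slope_parts loss g j)) (snd (slope_parts loss g j))).
  set (k := fun j => agreement (snd (side j)) (thr (fun _ => fst (side j)) eta1 s)
     (thr (fun _ => grid g j) eta2 (fun x => Some (b x)))).
  set (A := cell_predictor S B loss eta1 eta2 m G).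
  assert (Htrain : forall j, exists u, length u = t /\ incl u pts /\
    (Datatypes.S t * length (filter (mistake (A j) (k j) u) pts) <= 2 * m * length pts)%nat).
  { intros j; apply short_training_sequence; auto.
    - apply agreement_class_VC, HVC.
    - exists (thr (fun _ => fst (side j)) eta1 s),
        (thr (fun _ => grid g j) eta2 (fun x => Some (b x))).
      repeat split; [exists s; auto|].
      exists (fun x => Some (b x)); split; auto; exists b; auto. }
  destruct (ClassicalEpsilon.choice _ Htrain) as [u Hu].
  (* Star labels are stored as well, which keeps every block at length exactly [t]. *)
  set (mem := flat_map (fun j => map (fun z => (z, k j z)) (u j)) (seq 0 G)).
  destruct (indices_of pts x0 mem) as [desc [Hd1 [Hd2 Hd3]]].
  { intros p Hp; apply in_flat_map in Hp; destruct Hp as [j [_ Hp]].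
    apply in_map_iff in Hp; destruct Hp as [z [<- Hz]]; apply (Hu j), Hz. }
  exists desc; split; [|split; [exact Hd2|]].
  { rewrite Hd1; unfold mem; rewrite (flat_map_constant_length (c := t)).
    - rewrite length_seq; reflexivity.
    - intros j _; rewrite length_map; apply (Hu j). }
  rewrite Hd3; cbv zeta.
  set (err := fun j x => mistake (A j) (k j) (u j) x).
  eapply Rle_trans.
  - apply rsum_affine_le with (c := 2 * eta1 + 2 * eta2 + 2 * g) (g := g)
      (h := fun x => INR (count_below G (fun j => err j x))).
    intros x Hx; destruct (Hdef x Hx) as [q [Hq Hqr]].
    unfold defined_value; rewrite Hq.
    assert (HB : forall j, (j < G)%nat -> Rabs (snd (slope_parts loss g j)) <= g).
    { intros j Hj; pose proof (increment_abs (loss 1) G j (Hne 1 (or_introl eq_refl)) Hj) as H1.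
      pose proof (increment_abs (loss (-1)) G j (Hne (-1) (or_intror eq_refl)) Hj) as H2.
      fold g in H1, H2; apply Rabs_le_between in H1, H2; simpl; apply Rabs_le; lra. }
    assert (Hchunk : forall j, (j < G)%nat ->
      chunk t j mem = map (fun z => (z, k j z)) (u j)).
    { intros j Hj; unfold mem; rewrite (chunk_flat_map _ t G 0 j); auto.
      intros i; rewrite length_map; apply (Hu i). }
    apply grid_prediction_loss; auto; try lra.
    + intros a c w Ha Hc Hw; unfold cond_loss.
      pose proof (Hcv 1 (or_introl eq_refl) a c w Ha Hc Hw).
      pose proof (Hcv (-1) (or_intror eq_refl) a c w Ha Hc Hw). nra.
    + intros a c Ha Hc; unfold cond_loss.
      pose proof (Hne 1 (or_introl eq_refl) a c Ha Hc) as H1.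
      pose proof (Hne (-1) (or_intror eq_refl) a c Ha Hc) as H2.
      apply Rabs_le_between in H1, H2; apply Rabs_le; split; nra.
    + intros j Hj He Hi Hgr; fold g in Hi, Hgr.
      rewrite increment_cond_loss in Hi.
      pose proof (slope_side_neg _ _ g eta1 q He1 (HB j Hj) Hqr Hi) as Hside.
      rewrite Hchunk by auto.
      assert (Ek : k j x = Some true).
      { unfold k, agreement, thr at 1; rewrite Hq; fold (side j) in Hside.
        unfold thr; destruct (Rlt_dec (grid g j + eta2) (b x)); [|lra].
        destruct (snd (side j)).
        - destruct (Rlt_dec (fst (side j) + eta1) q); [reflexivity|lra].
        - destruct (Rlt_dec (fst (side j) + eta1) q); [lra|].
          destruct (Rlt_dec q (fst (side j) - eta1)); [reflexivity|lra]. }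
      unfold err, mistake in He; rewrite Ek in He.
      destruct (A j _ x); [reflexivity|discriminate He].
    + intros j Hj He Hi Hgr; fold g in Hi, Hgr.
      rewrite increment_cond_loss in Hi.
      pose proof (slope_side_pos _ _ g eta1 q He1 (HB j Hj) Hqr Hi) as Hside.
      rewrite Hchunk by auto.
      assert (Ek : k j x = Some false).
      { unfold k, agreement, thr at 1; rewrite Hq; fold (side j) in Hside.
        unfold thr; destruct (Rlt_dec (grid g j + eta2) (b x)); [lra|].
        destruct (Rlt_dec (b x) (grid g j - eta2)); [|lra].
        destruct (snd (side j)).
        - destruct (Rlt_dec (fst (side j) + eta1) q); [lra|].
          destruct (Rlt_dec q (fst (side j) - eta1)); [reflexivity|lra].
        - destruct (Rlt_dec (fst (side j) + eta1) q); [reflexivity|lra]. }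
      unfold err, mistake in He; rewrite Ek in He.
      destruct (A j _ x); [discriminate He|reflexivity].
  - rewrite rsum_count_swap, (Rmult_plus_distr_l _ (2 * eta1 + 2 * eta2 + 2 * g)).
    apply Rplus_le_compat_l.
    assert (Ht : 0 < INR (Datatypes.S t)) by (apply lt_0_INR; lia).
    (* Every cell errs on a fraction [2 * m / (t + 1)] of the points, and [g * INR G = 2] yields the
       factor 4. *)
    apply Rle_trans with (g * psum G (fun _ => 2 * INR m * INR (length pts) / INR (Datatypes.S t))).
    + apply Rmult_le_compat_l; [lra|]; apply psum_le; intros j _.
      apply Rle_div_r; [exact Ht|].
      destruct (Hu j) as [_ [_ Hle]]; apply le_INR in Hle.
      rewrite !mult_INR in Hle; change (INR 2) with 2 in Hle.
      unfold err; rewrite Rmult_comm; exact Hle.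
    + rewrite psum_const; unfold g; right; field; lra.
Qed.

(** * Empirical risk minimization over descriptions *)

Fixpoint words {A : Type} (T : nat) (alph : list A) : list (list A) :=
  match T with
  | O => [[]]
  | S T' => flat_map (fun a => map (cons a) (words T' alph)) alph
  end.

Lemma words_length {A : Type} (T : nat) (alph : list A) :
  length (words T alph) = (length alph ^ T)%nat.
Proof.
  induction T as [|T IH]; simpl; [reflexivity|].
  rewrite (flat_map_constant_length (c := length (words T alph))).
  - rewrite IH; ring.
  - intros a _; apply length_map.
Qed.

Lemma In_words {A : Type} (T : nat) (alph w : list A) :
  In w (words T alph) <-> length w = T /\ incl w alph.
Proof.
  revert w; induction T as [|T IH]; intros w; simpl.
  - split.
    + intros [<-|[]]; split; [reflexivity|intros x []].
    + intros [H _]; destruct w; [auto|discriminate H].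
  - rewrite in_flat_map; split.
    + intros [a [Ha Hw]]; apply in_map_iff in Hw; destruct Hw as [w' [<- Hw']].
      apply IH in Hw'; destruct Hw' as [<- Hi]; split; [reflexivity|].
      apply incl_cons; auto.
    + intros [Hl Hi]; destruct w as [|a w]; [discriminate Hl|].
      apply incl_cons_inv in Hi; destruct Hi as [Ha Hi].
      exists a; split; auto; apply in_map, IH; split; auto.
Qed.

Lemma argmin_exists {A : Type} (h : A -> R) (l : list A) :
  l <> [] -> exists a, In a l /\ forall a', In a' l -> h a <= h a'.
Proof.
  induction l as [|a l IH]; [contradiction|intros _].
  destruct l as [|a1 l1].
  - exists a; split; [left; auto|intros a' [->|[]]; lra].
  - destruct IH as [c [Hc Hmin]]; [discriminate|].
    destruct (Rle_dec (h a) (h c)) as [Hle|Hle].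
    + exists a; split; [left; auto|]; intros a' [->|Ha']; [lra|].
      specialize (Hmin a' Ha'); lra.
    + exists c; split; [right; auto|]; intros a' [->|Ha']; [lra|auto].
Qed.

Lemma Rabs_neg1_mult (x : R) : Rabs (-1 * x) = Rabs x.
Proof. rewrite <- Rabs_Ropp; f_equal; ring. Qed.

Lemma rsum_le {A : Type} (f h : A -> R) (l : list A) :
  (forall a, In a l -> f a <= h a) -> rsum (map f l) <= rsum (map h l).
Proof.
  induction l as [|a l IH]; intros H; simpl; [lra|].
  apply Rplus_le_compat; [apply H; left; auto|apply IH; intros; apply H; right; auto].
Qed.

Lemma rsum_minus {A : Type} (f h : A -> R) (l : list A) :
  rsum (map (fun a => f a - h a) l) = rsum (map f l) - rsum (map h l).
Proof. induction l as [|a l IH]; simpl; [ring|rewrite IH; ring]. Qed.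

Lemma rsum_const {A : Type} (c : R) (l : list A) :
  rsum (map (fun _ => c) l) = INR (length l) * c.
Proof.
  induction l as [|a l IH]; [simpl; ring|].
  simpl length; rewrite S_INR; simpl; rewrite IH; ring.
Qed.

Lemma rsum_ge_term {A : Type} (f : A -> R) (l : list A) (a : A) :
  (forall a, In a l -> 0 <= f a) -> In a l -> f a <= rsum (map f l).
Proof.
  induction l as [|c l IH]; intros H Ha; [contradiction|]; simpl.
  assert (0 <= f c) by (apply H; left; auto).
  assert (0 <= rsum (map f l)).
  { replace 0 with (rsum (map (fun _ : A => 0) l)) by (rewrite rsum_const; ring).
    apply rsum_le; intros; apply H; right; auto. }
  destruct Ha as [->|Ha]; [lra|].
  assert (f a <= rsum (map f l)) by (apply IH; auto; intros; apply H; right; auto); lra.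
Qed.

Lemma mean_rsum {X D : Type} (mu : dist X) (n : nat) (l : list D)
  (U : D -> list (nat * bool) -> R) (M : R) :
  0 <= M -> (forall d, In d l -> bdd n (U d) M) ->
  mean mu n (fun s => rsum (map (fun d => U d s) l)) = rsum (map (fun d => mean mu n (U d)) l).
Proof.
  intros HM; induction l as [|d l IH]; intros H; simpl; [apply mean_const|].
  rewrite <- IH by (intros; apply H; right; auto).
  apply mean_plus with (M := M + M * INR (length l)).
  - intros s Hs; pose proof (H d (or_introl eq_refl) s Hs).
    assert (0 <= M * INR (length l)) by (apply Rmult_le_pos; [lra|apply pos_INR]); lra.
  - intros s Hs.
    assert (Rabs (rsum (map (fun d => U d s) l)) <= M * INR (length l)); [|lra].
    clear IH; induction l as [|d' l IH]; [simpl; rewrite Rabs_R0; lra|].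
    simpl length; rewrite S_INR; simpl; eapply Rle_trans; [apply Rabs_triang|].
    pose proof (H d' (or_intror (or_introl eq_refl)) s Hs).
    enough (Rabs (rsum (map (fun d => U d s) l)) <= M * INR (length l)) by lra.
    apply IH; intros d'' [->|Hd]; apply H; simpl; auto.
Qed.

(** Markov's inequality and the union bound in one: on a bad sample in the support some [U d] is at
    least 1, so [1 - sum of U d] stays below the indicator of [Good]. Restricting to positive weight
    matters because realizability constrains only such atoms. *)
Lemma union_bound {X D : Type} (mu : dist X) (n : nat) (l : list D)
  (U : D -> list (nat * bool) -> R) (Good : list (nat * bool) -> Prop) (M eps : R) :
  (forall d s, In d l -> length s = n -> 0 <= U d s <= M) ->
  (forall d, In d l -> mean mu n (U d) <= eps) ->
  (forall s, length s = n -> List.Forall (fun z => 0 < wt mu (fst z)) s ->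
     (forall d, In d l -> U d s < 1) -> Good s) ->
  1 - INR (length l) * eps <= mean mu n (fun s => ind (Good s)).
Proof.
  intros HU Heps HG.
  assert (HM : forall d s, In d l -> length s = n -> Rabs (U d s) <= Rmax 0 M).
  { intros d s Hd Hs; destruct (HU d s Hd Hs); rewrite Rabs_pos_eq by auto.
    eapply Rle_trans; [eassumption|apply Rmax_r]. }
  assert (HS : bdd n (fun s => rsum (map (fun d => U d s) l)) (Rmax 0 M * INR (length l))).
  { intros s Hs; rewrite Rabs_pos_eq.
    - replace (Rmax 0 M * INR (length l)) with (rsum (map (fun _ : D => Rmax 0 M) l))
        by (rewrite rsum_const; ring).
      apply rsum_le; intros d Hd; apply Rabs_le_between, (HM d s Hd Hs).
    - replace 0 with (rsum (map (fun _ : D => 0) l)) by (rewrite rsum_const; ring).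
      apply rsum_le; intros d Hd; apply (HU d s Hd Hs). }
  assert (H1 : mean mu n (fun s => rsum (map (fun d => U d s) l)) <= INR (length l) * eps).
  { rewrite mean_rsum with (M := Rmax 0 M); [|apply Rmax_l|intros d Hd s Hs; auto].
    rewrite <- rsum_const; apply rsum_le; auto. }
  assert (H2 : mean mu n (fun s => 1 + (-1) * rsum (map (fun d => U d s) l))
               = 1 - mean mu n (fun s => rsum (map (fun d => U d s) l))).
  { rewrite mean_plus with (M := Rmax 1 (Rmax 0 M * INR (length l))).
    - rewrite mean_const, mean_scal; ring.
    - intros s _; rewrite Rabs_R1; apply Rmax_l.
    - intros s Hs; rewrite Rabs_neg1_mult.
      eapply Rle_trans; [apply HS, Hs|apply Rmax_r]. }
  assert (H3 : mean mu n (fun s => 1 + (-1) * rsum (map (fun d => U d s) l))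
               <= mean mu n (fun s => ind (Good s))); [|lra].
  apply mean_le with (M := 1 + Rmax 0 M * INR (length l)).
  - intros s Hs; specialize (HS s Hs); apply Rabs_le_between in HS.
    apply Rabs_le; split; lra.
  - intros s Hs; specialize (HS s Hs).
    pose proof (Rabs_pos (rsum (map (fun d => U d s) l))).
    unfold ind; destruct (excluded_middle_informative _); rewrite ?Rabs_R1, ?Rabs_R0; lra.
  - intros s Hs Hsupp; unfold ind; destruct (excluded_middle_informative _) as [HGs|HGs].
    + enough (0 <= rsum (map (fun d => U d s) l)) by lra.
      replace 0 with (rsum (map (fun _ : D => 0) l)) by (rewrite rsum_const; ring).
      apply rsum_le; intros d Hd; apply (HU d s Hd Hs).
    + enough (1 <= rsum (map (fun d => U d s) l)) by lra.
      apply NNPP; intros Hlt; apply HGs, HG; auto; intros d Hd.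
      eapply Rle_lt_trans; [|apply Rnot_le_lt, Hlt].
      apply (rsum_ge_term (fun d => U d s)); auto; intros d' Hd'; apply (HU d' s Hd' Hs).
Qed.

(** The sample supplies only its points; its labels are used solely to choose among descriptions. *)
Definition predictor {X : Type} (A : nat -> list (X * option bool) -> X -> bool)
  (G t : nat) (x0 : X) (desc : list (nat * option bool)) (smp : list (X * R)) : X -> R :=
  reconstruct A G t (map (fun p => (nth (fst p) (map fst smp) x0, snd p)) desc).

Definition empirical_loss {X : Type} (loss : R -> R -> R) (smp : list (X * R)) (f : X -> R)
  : R := rsum (map (fun z => loss (snd z) (f (fst z))) smp).

Definition descriptions (n T : nat) : list (list (nat * option bool)) :=
  words T (list_prod (seq 0 n) [None; Some true; Some false]).

Definition erm {X : Type} (loss : R -> R -> R) (A : nat -> list (X * option bool) -> X -> bool)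
  (G t n : nat) (x0 : X) (smp : list (X * R)) : X -> R :=
  predictor A G t x0
    (epsilon (inhabits []) (fun d => In d (descriptions n (G * t)) /\
       forall d', In d' (descriptions n (G * t)) ->
         empirical_loss loss smp (predictor A G t x0 d smp)
         <= empirical_loss loss smp (predictor A G t x0 d' smp))) smp.

Lemma predictor_range {X : Type} (A : nat -> list (X * option bool) -> X -> bool)
  (G t : nat) (x0 : X) desc (smp : list (X * R)) (x : X) :
  (0 < G)%nat -> -1 <= predictor A G t x0 desc smp x <= 1.
Proof. intros HG; apply grid_range; auto; apply count_below_le. Qed.

Lemma erm_spec {X : Type} (loss : R -> R -> R)
  (A : nat -> list (X * option bool) -> X -> bool) (G t n : nat) (x0 : X)
  (smp : list (X * R)) :
  (0 < n)%nat ->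
  exists d, In d (descriptions n (G * t)) /\ erm loss A G t n x0 smp = predictor A G t x0 d smp /\
    forall d', In d' (descriptions n (G * t)) ->
      empirical_loss loss smp (predictor A G t x0 d smp)
      <= empirical_loss loss smp (predictor A G t x0 d' smp).
Proof.
  intros Hn.
  destruct (epsilon_spec (inhabits []) (fun d => In d (descriptions n (G * t)) /\
       forall d', In d' (descriptions n (G * t)) ->
         empirical_loss loss smp (predictor A G t x0 d smp)
         <= empirical_loss loss smp (predictor A G t x0 d' smp))) as [H1 H2].
  { apply argmin_exists; intros E.
    assert (HL : length (descriptions n (G * t)) <> 0%nat).
    { unfold descriptions; rewrite words_length, length_prod, length_seq.
      apply Nat.pow_nonzero; simpl; lia. }
    rewrite E in HL; apply HL; reflexivity. }
  eexists; split; [exact H1|split; [reflexivity|exact H2]].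
Qed.

(** * Excess risk and its deviations on a sample *)

Lemma risk_mean1 {X : Type} (mu : dist X) (loss : R -> R -> R) (f : X -> R) :
  risk mu loss f
  = mean1 mu (fun z => loss (snd (example mu z)) (f (fst (example mu z)))).
Proof. reflexivity. Qed.

Lemma label_cases {X : Type} (mu : dist X) (z : nat * bool) :
  snd (example mu z) = 1 \/ snd (example mu z) = -1.
Proof. unfold example; simpl; destruct (snd z); auto. Qed.

Lemma loss_bound (loss : R -> R -> R) :
  (forall y, y = 1 \/ y = -1 -> nonexpansive_on_interval (loss y)) ->
  exists M, forall y a, y = 1 \/ y = -1 -> -1 <= a <= 1 -> Rabs (loss y a) <= M.
Proof.
  intros H; exists (Rabs (loss 1 0) + Rabs (loss (-1) 0) + 1); intros y a Hy Ha.
  pose proof (H y Hy a 0 Ha ltac:(lra)) as Hl.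
  assert (Rabs (a - 0) <= 1) by (apply Rabs_le; lra).
  assert (Rabs (loss y a) <= Rabs (loss y 0) + Rabs (loss y a - loss y 0)).
  { replace (loss y a) with (loss y 0 + (loss y a - loss y 0)) at 1 by ring.
    apply Rabs_triang. }
  pose proof (Rabs_pos (loss 1 0)); pose proof (Rabs_pos (loss (-1) 0)).
  destruct Hy as [->| ->]; lra.
Qed.

(** The infimum over [B] need not be attained, and the comparator has to be fixed before the sample
    is drawn. *)
Lemma near_optimal {X : Type} (mu : dist X) (B : (X -> R) -> Prop) (loss : R -> R -> R)
  (eps : R) :
  (forall y, y = 1 \/ y = -1 -> nonexpansive_on_interval (loss y)) ->
  (forall b, B b -> forall x, -1 <= b x <= 1) -> (exists b, B b) -> 0 < eps ->
  exists b, B b /\ forall b', B b' -> risk mu loss b <= risk mu loss b' + eps.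
Proof.
  intros Hne HB [b0 Hb0] Heps.
  destruct (loss_bound loss Hne) as [M HM].
  destruct (completeness (fun r => exists b, B b /\ r = - risk mu loss b)) as [l [Hub Hlub]].
  - exists M; intros r [b [Hb ->]].
    enough (Rabs (risk mu loss b) <= M) as Hr
      by (apply Rabs_le_between in Hr; lra).
    rewrite risk_mean1; apply mean1_abs; intros z; apply HM; [apply label_cases|apply HB, Hb].
  - exists (- risk mu loss b0); exists b0; auto.
  - apply NNPP; intros Hno.
    assert (l <= l - eps); [|lra].
    apply Hlub; intros r [b [Hb ->]]; apply Rnot_lt_le; intros Hlt.
    apply Hno; exists b; split; auto; intros b' Hb'.
    assert (- risk mu loss b' <= l) by (apply Hub; exists b'; auto); lra.
Qed.

Definition point_mass (j : nat) : R := match j with O => 1 | _ => 0 end.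

Lemma point_mass_series : is_series point_mass 1.
Proof.
  apply (is_lim_seq_ext (fun _ => 1) _ (Finite 1)); [|apply is_lim_seq_const].
  induction n as [|n IH]; [rewrite sum_O; reflexivity|].
  rewrite sum_Sn, <- IH; unfold plus; simpl; ring.
Qed.

(** Supplies the locality hypothesis of [compression_exp_moment]. An index beyond the sample reads
    the default [x0] in both samples. *)
Lemma predictor_local {X : Type} (mu : dist X)
  (A : nat -> list (X * option bool) -> X -> bool) (G t n : nat) (x0 : X) desc
  (s s' : list (nat * bool)) :
  length s = n -> length s' = n ->
  (forall i, In i (map fst desc) -> (i < n)%nat ->
     nth i s (0%nat, true) = nth i s' (0%nat, true)) ->
  predictor A G t x0 desc (map (example mu) s) = predictor A G t x0 desc (map (example mu) s').
Proof.
  intros Hs Hs' H; unfold predictor; f_equal; apply map_ext_in; intros p Hp; f_equal.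
  rewrite !map_map.
  destruct (Nat.lt_ge_cases (fst p) n) as [Hlt|Hge].
  - rewrite !(nth_indep _ x0 (fst (example mu (0%nat, true))))
      by (rewrite length_map; lia).
    rewrite !(map_nth (fun z => fst (example mu z))), H; auto; apply in_map, Hp.
  - rewrite !nth_overflow by (rewrite length_map; lia); reflexivity.
Qed.

(** A 1-Lipschitz loss may itself be arbitrarily large, but its difference with the loss of [b] is
    at most 2, the length of the interval. Hence deviations are measured on differences. *)
Definition excess {X : Type} (mu : dist X) (loss : R -> R -> R) (b f : X -> R)
  (z : nat * bool) : R :=
  loss (snd (example mu z)) (f (fst (example mu z)))
  - loss (snd (example mu z)) (b (fst (example mu z))).

Lemma excess_abs {X : Type} (mu : dist X) (loss : R -> R -> R) (b f : X -> R)
  (z : nat * bool) :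
  (forall y, y = 1 \/ y = -1 -> nonexpansive_on_interval (loss y)) ->
  (forall x, -1 <= b x <= 1) -> (forall x, -1 <= f x <= 1) ->
  Rabs (excess mu loss b f z) <= 2.
Proof.
  intros Hne Hb Hf; eapply Rle_trans; [apply Hne; auto; apply label_cases|].
  set (x := fst (example mu z)).
  specialize (Hf x); specialize (Hb x); apply Rabs_le; lra.
Qed.

Lemma mean1_excess {X : Type} (mu : dist X) (loss : R -> R -> R) (b f : X -> R) :
  (forall y, y = 1 \/ y = -1 -> nonexpansive_on_interval (loss y)) ->
  (forall x, -1 <= b x <= 1) -> (forall x, -1 <= f x <= 1) ->
  mean1 mu (excess mu loss b f) = risk mu loss f - risk mu loss b.
Proof.
  intros Hne Hb Hf; destruct (loss_bound loss Hne) as [M HM].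
  rewrite !risk_mean1; unfold excess.
  rewrite (mean1_ext _ _ (fun z => loss (snd (example mu z)) (f (fst (example mu z)))
    + (-1) * loss (snd (example mu z)) (b (fst (example mu z))))) by (intros; ring).
  rewrite mean1_plus with (M := M).
  - rewrite mean1_scal; ring.
  - intros z; apply HM; [apply label_cases|auto].
  - intros z; rewrite Rabs_neg1_mult; apply HM;
      [apply label_cases|auto].
Qed.

Lemma mean1_true_deviation {X : Type} (mu : dist X) (loss : R -> R -> R) (b f : X -> R) :
  (forall y, y = 1 \/ y = -1 -> nonexpansive_on_interval (loss y)) ->
  (forall x, -1 <= b x <= 1) -> (forall x, -1 <= f x <= 1) ->
  mean1 mu (fun z => mean1 mu (excess mu loss b f) - excess mu loss b f z) = 0.
Proof.
  intros Hne Hb Hf; pose proof (fun z => excess_abs mu loss b f z Hne Hb Hf) as Habs.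
  set (e := excess mu loss b f) in *.
  rewrite (mean1_ext _ _ (fun z => mean1 mu e + (-1) * e z)) by (intros; ring).
  rewrite mean1_plus with (M := 2).
  - rewrite mean1_const, mean1_scal; ring.
  - intros _; apply mean1_abs, Habs.
  - intros z; rewrite Rabs_neg1_mult; apply Habs.
Qed.

(** Pure label noise: [mix mu F] is the conditional mean of [F] given the atom. *)
Lemma mean1_label_deviation {X : Type} (mu : dist X) (F : nat * bool -> R) :
  mean1 mu (fun z => F z - mix mu F (fst z)) = 0.
Proof.
  rewrite <- (mean1_const mu 0); apply Series_ext; intros i; unfold mix; simpl; ring.
Qed.

(** The choice [lam = beta / 256] with [c = 4] makes the second-order term
    [(lam * c) ^ 2 = beta ^ 2 / 4096] half of the gain [lam * beta / 8] from the threshold. *)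
Lemma exp_deviation_bound {X : Type} (mu : dist X) (n : nat) (I : list nat)
  (Psi : list (nat * bool) -> nat * bool -> R) (beta : R) :
  0 < beta < 1/2 ->
  (forall s z, Rabs (Psi s z) <= 4) ->
  (forall s, mean1 mu (Psi s) = 0) ->
  (forall s s', length s = n -> length s' = n ->
     (forall i, In i I -> (i < n)%nat -> nth i s (0%nat, true) = nth i s' (0%nat, true)) ->
     forall z, Psi s z = Psi s' z) ->
  mean mu n (fun s => exp (beta / 256 * (rsum (map (Psi s) s) - beta / 8 * INR n)))
  <= exp (beta / 64 * INR (length I) - beta ^ 2 * INR n / 4096).
Proof.
  intros Hbeta H1 H2 H3.
  rewrite (mean_ext _ _ _ (fun s => exp (- (beta ^ 2 * INR n / 2048))
    * exp (beta / 256 * rsum (map (Psi s) s)))).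
  - rewrite mean_scal.
    pose proof (compression_exp_moment mu n I Psi (beta / 256) 4
      ltac:(lra) ltac:(lra) H1 H2 H3) as H.
    eapply Rle_trans; [apply Rmult_le_compat_l; [left; apply exp_pos|exact H]|].
    rewrite <- exp_plus; right; f_equal; field.
  - intros s _; rewrite <- exp_plus; f_equal; field.
Qed.

Lemma mix_excess {X : Type} (mu : dist X) (loss : R -> R -> R) (b f : X -> R)
  (s : X -> option R) (i : nat) :
  s (atom mu i) = Some (2 * cp mu i - 1) ->
  mix mu (excess mu loss b f) i
  = cond_loss loss (defined_value s (atom mu i)) (f (atom mu i))
    - cond_loss loss (defined_value s (atom mu i)) (b (atom mu i)).
Proof.
  intros H; unfold mix, excess, cond_loss, defined_value; rewrite H; simpl; field.
Qed.

(** The pair [loss'], [eps'] with its transfer hypothesis lets the argument run on a 1-Lipschitz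
    loss and conclude for the original one. *)
Lemma erm_learns {X : Type} (S : (X -> option R) -> Prop) (B : (X -> R) -> Prop)
  (loss loss' : R -> R -> R) (beta eta1 eta2 delta eps' : R) (m G t n : nat) :
  inhabited X ->
  (forall s, S s -> forall x v, s x = Some v -> -1 <= v <= 1) ->
  (forall b, B b -> forall x, -1 <= b x <= 1) ->
  (forall y, y = 1 \/ y = -1 -> convex_on_interval (loss y)) ->
  (forall y, y = 1 \/ y = -1 -> nonexpansive_on_interval (loss y)) ->
  (forall (mu : dist X) f b, (forall x, -1 <= f x <= 1) -> (forall x, -1 <= b x <= 1) ->
     risk mu loss f <= risk mu loss b + (beta + 2 * eta1 + 4 * eta2) ->
     risk mu loss' f <= risk mu loss' b + eps') ->
  0 < beta < 1/2 -> 0 < eta1 < 1/2 -> 0 < eta2 < 1/2 -> 0 < delta < 1/2 ->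
  supVC_le S B eta1 eta2 m ->
  16 / beta <= INR G -> 16 * INR m / beta <= INR (Datatypes.S t) -> (0 < n)%nat ->
  2 * INR (G * t) * ln (3 * INR n) + 2 * ln (1 / delta) <= beta ^ 2 * INR n / 4096 ->
  CompR n S B loss' eps' delta.
Proof.
  intros [x0] HS HB Hcv Hne Htr Hbeta He1 He2 Hdelta HVC HG Ht Hn Hsize.
  assert (HGr : 0 < INR G).
  { apply Rlt_le_trans with (16 / beta); auto; apply Rdiv_lt_0_compat; lra. }
  assert (HG0 : (0 < G)%nat) by (apply INR_lt; simpl; exact HGr).
  assert (Hnr : 0 < INR n) by (apply lt_0_INR; auto).
  set (A := cell_predictor S B loss eta1 eta2 m G).
  exists (fun _ => erm loss A G t n x0), point_mass.
  split; [intros [|j]; simpl; lra|]; split; [apply point_mass_series|].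
  split; [intros _ smp x; apply predictor_range, HG0|].
  intros mu [s [HSs Hreal]].
  rewrite Series_scal_r, (is_series_unique _ _ point_mass_series), Rmult_1_l.
  apply Rle_ge; rewrite sprob_mean.
  (* With [B] empty the guarantee is vacuous and every sample is good. *)
  destruct (classic (exists b, B b)) as [Hex|Hno].
  2:{ rewrite (mean_ext _ _ _ (fun _ => 1)); [rewrite mean_const; lra|].
      intros smp _; unfold ind; destruct (excluded_middle_informative _) as [|H]; auto.
      exfalso; apply H; intros b Hb; exfalso; eauto. }
  destruct (near_optimal mu B loss (beta / 8) Hne HB Hex ltac:(lra)) as [b [Hb Hopt]].
  assert (Hbr := HB b Hb).
  set (f := fun d smp => predictor A G t x0 d (map (example mu) smp)).
  assert (Hfr : forall d smp x, -1 <= f d smp x <= 1)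
    by (intros; apply predictor_range, HG0).
  set (exc := excess mu loss b).
  (* [Psi1] bounds the risk of the minimizer by its empirical excess; [Psi2] bounds the empirical
     excess of the good description by its conditional excess. Both descriptions depend on the
     sample, so both deviations are controlled for all [d]. *)
  set (Psi1 := fun d smp z => mean1 mu (exc (f d smp)) - exc (f d smp) z).
  set (Psi2 := fun d smp z => exc (f d smp) z - mix mu (exc (f d smp)) (fst z)).
  assert (Habs : forall d smp z, Rabs (exc (f d smp) z) <= 2)
    by (intros; apply excess_abs; auto).
  assert (HP1 : forall d smp z, Rabs (Psi1 d smp z) <= 4).
  { intros d smp z; unfold Psi1.
    pose proof (Habs d smp z) as H1.
    pose proof (mean1_abs mu _ 2 (Habs d smp)) as H2.
    apply Rabs_le_between in H1, H2; apply Rabs_le; lra. }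
  assert (HP2 : forall d smp z, Rabs (Psi2 d smp z) <= 4).
  { intros d smp z; unfold Psi2.
    pose proof (Habs d smp z) as H1.
    pose proof (mix_abs mu _ 2 (fst z) (Habs d smp)) as H2.
    apply Rabs_le_between in H1, H2; apply Rabs_le; lra. }
  set (dev := fun (Psi : list (nat * bool) -> nat * bool -> R) smp =>
    exp (beta / 256 * (rsum (map (Psi smp) smp) - beta / 8 * INR n))).
  set (U := fun d smp => dev (Psi1 d) smp + dev (Psi2 d) smp).
  assert (Hdev : forall Psi : list (nat * bool) -> nat * bool -> R,
    (forall smp z, Rabs (Psi smp z) <= 4) ->
    forall smp, length smp = n -> 0 <= dev Psi smp <= exp (INR n)).
  { intros Psi HP smp Hs; split; [left; apply exp_pos|]; apply exp_le.
    pose proof (rsum_abs (Psi smp) smp 4 (HP smp)) as H; rewrite Hs in H.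
    apply Rabs_le_between in H.
    apply Rle_trans with (beta / 256 * (4 * INR n)); [|nra].
    apply Rmult_le_compat_l; [lra|]; nra. }
  set (T := (G * t)%nat) in *.
  set (rate := exp (beta / 64 * INR T - beta ^ 2 * INR n / 4096)).
  assert (Hlocal : forall d smp smp', length smp = n -> length smp' = n ->
     (forall i, In i (map fst d) -> (i < n)%nat ->
        nth i smp (0%nat, true) = nth i smp' (0%nat, true)) -> f d smp = f d smp').
  { intros d smp smp' H1 H2 H3; unfold f; eapply predictor_local; eauto. }
  assert (HlenT : forall d, In d (descriptions n T) -> length (map fst d) = T).
  { intros d Hd; rewrite length_map; apply In_words in Hd; tauto. }
  assert (Hrate : forall d, In d (descriptions n T) -> mean mu n (U d) <= 2 * rate).
  { intros d Hd; unfold U.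
    rewrite mean_plus with (M := exp (INR n)).
    - assert (H1 : mean mu n (dev (Psi1 d)) <= rate).
      { unfold rate; rewrite <- (HlenT d Hd); apply exp_deviation_bound; auto.
        - intros smp; apply mean1_true_deviation; auto.
        - intros smp smp' H1 H2 H3 z; unfold Psi1; rewrite (Hlocal d smp smp'); auto. }
      assert (H2 : mean mu n (dev (Psi2 d)) <= rate).
      { unfold rate; rewrite <- (HlenT d Hd); apply exp_deviation_bound; auto.
        - intros smp; apply mean1_label_deviation.
        - intros smp smp' H3 H4 H5 z; unfold Psi2; rewrite (Hlocal d smp smp'); auto. }
      lra.
    - intros smp Hs; destruct (Hdev (Psi1 d) (HP1 d) smp Hs); rewrite Rabs_pos_eq; auto.
    - intros smp Hs; destruct (Hdev (Psi2 d) (HP2 d) smp Hs); rewrite Rabs_pos_eq; auto. }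
  assert (Hfail : INR (length (descriptions n T)) * (2 * rate) <= delta).
  { unfold descriptions; rewrite words_length, length_prod, length_seq, pow_INR, mult_INR.
    replace (INR (length [None; Some true; Some false])) with 3 by (simpl; lra).
    assert (Hn1 : 1 <= INR n) by (apply (le_INR 1); lia).
    replace (INR n * 3) with (exp (ln (3 * INR n))) by (rewrite exp_ln; lra).
    assert (Hpow : forall k, exp (ln (3 * INR n)) ^ k = exp (INR k * ln (3 * INR n))).
    { induction k as [|k IHk]; [simpl; rewrite Rmult_0_l, exp_0; reflexivity|].
      rewrite S_INR; simpl; rewrite IHk, <- exp_plus; f_equal; ring. }
    rewrite Hpow; unfold rate.
    assert (Hln2 := ln_lt_2).
    assert (Hl3 : ln 2 <= ln (3 * INR n)) by (apply ln_le; lra).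
    assert (Hld : ln 2 <= ln (1 / delta)).
    { apply ln_le; [lra|]; apply Rle_div_r; lra. }
    assert (HT : 0 <= INR T) by apply pos_INR.
    replace 2 with (exp (ln 2)) at 1 by (rewrite exp_ln; lra).
    rewrite <- !exp_plus.
    (* The doubled terms in [Hsize] absorb the compression cost, as [beta / 64 <= ln (3 * INR n)],
       and the factor 2 for two deviations, as [ln 2 <= ln (1 / delta)]. *)
    apply Rle_trans with (exp (- ln (1 / delta))).
    - apply exp_le; nra.
    - unfold Rdiv; rewrite Rmult_1_l, ln_Rinv, Ropp_involutive, exp_ln by lra; lra. }
  eapply Rle_trans; [|apply union_bound with (l := descriptions n T) (U := U)
    (M := 2 * exp (INR n)) (eps := 2 * rate); auto].
  - lra.
  - intros d smp _ Hs; unfold U.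
    pose proof (Hdev _ (HP1 d) smp Hs); pose proof (Hdev _ (HP2 d) smp Hs); lra.
  - intros smp Hs Hsupp HU b' Hb'.
    assert (HU' : forall d, In d (descriptions n T) ->
      rsum (map (Psi1 d smp) smp) <= beta / 8 * INR n /\
      rsum (map (Psi2 d smp) smp) <= beta / 8 * INR n).
    { intros d Hd; specialize (HU d Hd); unfold U, dev in HU.
      assert (Hexp : forall w, exp (beta / 256 * w) < 1 -> w <= 0).
      { intros w Hw; apply Rnot_lt_le; intros Hpos.
        pose proof (exp_ineq1_le (beta / 256 * w)).
        assert (0 < beta / 256 * w) by (apply Rmult_lt_0_compat; lra). lra. }
      split; [specialize (Hexp (rsum (map (Psi1 d smp) smp) - beta / 8 * INR n))
             |specialize (Hexp (rsum (map (Psi2 d smp) smp) - beta / 8 * INR n))].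
      - pose proof (exp_pos (beta / 256 * (rsum (map (Psi2 d smp) smp) - beta / 8 * INR n))).
        assert (rsum (map (Psi1 d smp) smp) - beta / 8 * INR n <= 0) by (apply Hexp; lra); lra.
      - pose proof (exp_pos (beta / 256 * (rsum (map (Psi1 d smp) smp) - beta / 8 * INR n))).
        assert (rsum (map (Psi2 d smp) smp) - beta / 8 * INR n <= 0) by (apply Hexp; lra); lra. }
    set (pts := map fst (map (example mu) smp)).
    assert (Hlpts : length pts = n) by (unfold pts; rewrite !length_map; auto).
    assert (Hsup : forall z, In z smp -> s (atom mu (fst z)) = Some (2 * cp mu (fst z) - 1)).
    { intros z Hz; apply Hreal; rewrite List.Forall_forall in Hsupp; auto. }
    destruct (short_description S B loss eta1 eta2 m G t s b pts x0)
      as [d0 [Hd0 [Hd0n Hd0e]]]; auto; try lra.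
    { intros x Hx; unfold pts in Hx; rewrite map_map in Hx; apply in_map_iff in Hx.
      destruct Hx as [z [<- Hz]]; exists (2 * cp mu (fst z) - 1).
      split; [apply (Hsup z Hz)|]; apply (HS s HSs _ _ (Hsup z Hz)). }
    { intros E; rewrite E in Hlpts; simpl in Hlpts; lia. }
    assert (Hd0in : In d0 (descriptions n T)).
    { apply In_words; split; auto; intros [i c] Hp; apply in_prod.
      - apply in_seq; specialize (Hd0n _ Hp); simpl in Hd0n; lia.
      - destruct c as [[]|]; simpl; auto. }
    cbv zeta in Hd0e; fold A in Hd0e.
    change (reconstruct A G t _) with (f d0 smp) in Hd0e.
    rewrite Hlpts in Hd0e; unfold pts in Hd0e; rewrite !map_map in Hd0e.
    (* Realizability at the drawn atoms identifies the conditional excess of [short_description]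
       with the label average in [Psi2]. *)
    rewrite (map_ext_in _ (fun z => mix mu (exc (f d0 smp)) (fst z))) in Hd0e.
    2:{ intros z Hz; simpl; symmetry; apply mix_excess, Hsup, Hz. }
    destruct (erm_spec loss A G t n x0 (map (example mu) smp) Hn)
      as [d1 [Hd1 [-> Hmin]]]; fold T in Hd1, Hmin.
    specialize (Hmin d0 Hd0in).
    change (empirical_loss loss (map (example mu) smp) (f d1 smp)
            <= empirical_loss loss (map (example mu) smp) (f d0 smp)) in Hmin.
    change (risk mu loss' (f d1 smp) <= risk mu loss' b' + eps').
    assert (Hemp : forall d, rsum (map (exc (f d smp)) smp)
      = empirical_loss loss (map (example mu) smp) (f d smp)
        - empirical_loss loss (map (example mu) smp) b).
    { intros d; unfold empirical_loss; rewrite !map_map, <- rsum_minus; reflexivity. }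
    destruct (HU' d1 Hd1) as [Hdev1 _]; destruct (HU' d0 Hd0in) as [_ Hdev2].
    unfold Psi1 in Hdev1; unfold Psi2 in Hdev2; rewrite rsum_minus in Hdev1, Hdev2.
    rewrite rsum_const, Hs, Hemp in Hdev1; rewrite Hemp in Hdev2.
    unfold exc in Hdev1 at 1; rewrite mean1_excess in Hdev1 by auto.
    specialize (Hopt b' Hb').
    apply Htr; auto.
    (* Spending of [beta]: an eighth for each of the two deviations and for near-optimality of [b],
       a quarter for the grid, a quarter for the errors of the cell learners. *)
    assert (HgG : 2 / INR G <= beta / 8).
    { apply Rle_div_l; auto; apply Rle_div_l in HG; [|lra]. lra. }
    assert (Hmt : 4 * INR m / INR (Datatypes.S t) <= beta / 4).
    { assert (0 < INR (Datatypes.S t)) by (apply lt_0_INR; lia).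
      apply Rle_div_l; auto; apply Rle_div_l in Ht; [|lra]. lra. }
    set (gam := 2 * eta1 + 2 * eta2 + 2 * (2 / INR G) + 4 * INR m / INR (Datatypes.S t)) in *.
    assert (Hfin : INR n * (risk mu loss (f d1 smp) - risk mu loss b)
      <= INR n * (beta / 4 + gam)) by lra.
    apply Rmult_le_reg_l in Hfin; auto; unfold gam in Hfin; lra.
Qed.

(** * Sample size *)

Lemma half_lt_ln_inv (x : R) : 0 < x < 1/2 -> 1/2 < ln (1 / x).
Proof.
  intros Hx; pose proof ln_lt_2.
  assert (ln 2 <= ln (1 / x)); [|lra].
  apply ln_le; [lra|]; apply Rle_div_r; lra.
Qed.

(** Tangent bound with a free point [A]; it resolves the requirement on [n] in which [n] also stands
    inside a logarithm. *)
Lemma ln_le_affine (x A : R) : 0 < x -> 0 < A -> ln x <= x / A + ln A.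
Proof.
  intros Hx HA.
  assert (Hq : 0 < x / A) by (apply Rdiv_lt_0_compat; auto).
  replace x with (x / A * A) at 1 by (field; lra).
  rewrite ln_mult by auto.
  pose proof (exp_ineq1_le (ln (x / A))) as H; rewrite exp_ln in H by auto; lra.
Qed.

Lemma log_plus_ge1 (u : R) : 1 <= log_plus u.
Proof.
  unfold log_plus, log2; pose proof ln_lt_2.
  apply Rle_div_r; [lra|]; rewrite Rmult_1_l; apply ln_le; [lra|apply Rmax_l].
Qed.

Lemma ln2_lt1 : ln 2 < 1.
Proof.
  assert (H : ln 2 < ln (exp 1)); [|rewrite ln_exp in H; exact H].
  apply ln_increasing; [lra|]; pose proof (exp_ineq1 1 ltac:(lra)); lra.
Qed.

Lemma ln_le_log_plus (u : R) : 0 < u -> ln u <= log_plus u.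
Proof.
  intros Hu; unfold log_plus, log2; pose proof ln_lt_2; pose proof ln2_lt1.
  assert (0 <= ln (Rmax 2 u)).
  { rewrite <- ln_1; apply ln_le; [lra|]; pose proof (Rmax_l 2 u); lra. }
  assert (ln u <= ln (Rmax 2 u)) by (apply ln_le; [auto|apply Rmax_r]).
  apply Rle_div_r; [lra|]; nra.
Qed.

(** Here [a] is [1 / beta]. The tangent point [A] is chosen so that its linear term is at most
    [n / (8192 * a ^ 2)]: [13369344 = 2 * 272 * 3 * 8192]. As [13369344 <= 2 ^ 24], also
    [ln A <= 24 + 4 * L <= 28 * L], and [15232 = 2 * 272 * 28]. *)
Lemma description_budget (M a L T n : R) :
  1 <= M -> 2 <= a -> ln (M * a) <= L -> 1 <= L -> 0 < n ->
  0 <= T <= 272 * M * a ^ 2 ->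
  2 * T * ln (3 * n) <= n / (8192 * a ^ 2) + 15232 * (M * L * a ^ 2).
Proof.
  intros HM Ha HL HL1 Hn HT.
  set (A := 13369344 * M * a ^ 4).
  assert (Ha4 : 0 < a ^ 4) by (apply pow_lt; lra).
  assert (HMa : 0 < M * a ^ 4) by (apply Rmult_lt_0_compat; lra).
  assert (HA : 0 < A) by (unfold A; lra).
  pose proof (ln_le_affine (3 * n) A ltac:(lra) HA) as H1.
  assert (H2 : ln A <= 28 * L).
  { assert (HlnM : 0 <= ln M) by (rewrite <- ln_1; apply ln_le; lra).
    unfold A; rewrite Rmult_assoc, ln_mult, ln_mult, ln_pow by lra.
    rewrite ln_mult in HL by lra.
    assert (ln 13369344 <= 24); [|simpl; lra].
    apply Rle_trans with (ln (2 ^ 24)); [apply ln_le; lra|].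
    rewrite ln_pow by lra; pose proof ln2_lt1; simpl; lra. }
  assert (H3 : 2 * T * (3 * n / A) <= n / (8192 * a ^ 2)).
  { apply Rle_trans with (2 * (272 * M * a ^ 2) * (3 * n / A)).
    - apply Rmult_le_compat_r; [left; apply Rdiv_lt_0_compat; lra|lra].
    - right; unfold A; field; lra. }
  assert (H4 : 2 * T * ln A <= 15232 * (M * L * a ^ 2)).
  { apply Rle_trans with (2 * T * (28 * L)); [apply Rmult_le_compat_l; lra|].
    nra. }
  assert (2 * T * ln (3 * n) <= 2 * T * (3 * n / A + ln A)); [|lra].
  apply Rmult_le_compat_l; lra.
Qed.

Lemma sample_size (m : nat) (beta eta1 eta2 delta : R) :
  0 < beta < 1/2 -> 0 < eta1 < 1/2 -> 0 < eta2 < 1/2 -> 0 < delta < 1/2 ->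
  exists G t n : nat,
    16 / beta <= INR G /\ 16 * INR m / beta <= INR (S t) /\ (0 < n)%nat /\
    2 * INR (G * t) * ln (3 * INR n) + 2 * ln (1 / delta) <= beta ^ 2 * INR n / 4096 /\
    INR n <= 300000000 *
      (INR m / beta ^ 6 * (log_plus (INR m / beta)) ^ 2 * ln (1 / eta1)
       + 1 / beta ^ 6 * ln (1 / eta1) * ln (1 / (beta * delta))
       + 1 / beta ^ 4 * ln (1 / eta2)).
Proof.
  intros Hbeta He1 He2 Hdelta.
  set (a := / beta); set (M := INR m).
  assert (Ha : 2 < a) by (unfold a; apply Rmult_lt_reg_r with beta; [lra|];
    rewrite Rinv_l; lra).
  assert (Hab : beta = / a) by (unfold a; rewrite Rinv_inv; reflexivity).
  assert (HM : 0 <= M) by apply pos_INR.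
  set (L := log_plus (M / beta)).
  assert (HL : 1 <= L) by apply log_plus_ge1.
  set (lam := ln (1 / delta)).
  assert (Hlam : 1/2 < lam) by (apply half_lt_ln_inv; auto).
  assert (HMa : 0 <= 16 * M * a) by (repeat apply Rmult_le_pos; lra).
  destruct (nfloor_ex (16 * a) ltac:(lra)) as [G0 HG0].
  destruct (nfloor_ex (16 * M * a) HMa) as [t Ht].
  (* The requirement on [n] has [2 * n / (8192 * a ^ 2)] on its right; [description_budget] consumes
     half, and [w] makes the other half cover the remaining terms. *)
  set (w := 8192 * (15232 * (M * L * a ^ 4) + 2 * (lam * a ^ 2))).
  assert (HMLa : 0 <= M * L * a ^ 4)
    by (apply Rmult_le_pos; [apply Rmult_le_pos; lra|apply pow_le; lra]).
  assert (Hla : 0 < lam * a ^ 2) by (apply Rmult_lt_0_compat; [lra|apply pow_lt; lra]).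
  destruct (nfloor_ex w ltac:(unfold w; lra)) as [n0 Hn0].
  exists (S G0), t, (S n0).
  assert (Hn : 0 < INR (S n0)) by (apply lt_0_INR; lia).
  (* The extra 1 from rounding up is at most [a]; hence 17, and [272 = 17 * 16] below. *)
  assert (HGr : INR (S G0) <= 17 * a) by (rewrite S_INR; lra).
  assert (Htr : 0 <= INR t <= 16 * M * a) by (split; [apply pos_INR|lra]).
  assert (HT : 0 <= INR (S G0 * t) <= 272 * M * a ^ 2).
  { split; [apply pos_INR|]; rewrite mult_INR.
    apply Rle_trans with (17 * a * (16 * M * a)); [|right; ring].
    apply Rmult_le_compat; try lra; apply pos_INR. }
  split; [unfold Rdiv; fold a; rewrite S_INR; lra|].
  split; [unfold Rdiv; fold a; rewrite S_INR; fold M; lra|].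
  split; [lia|]; split.
  - assert (Hw : 15232 * (M * L * a ^ 2) + 2 * lam <= INR (S n0) / (8192 * a ^ 2)).
    { apply Rle_div_r; [apply Rmult_lt_0_compat; [lra|apply pow_lt; lra]|].
      replace (_ * (8192 * a ^ 2)) with w by (unfold w; ring).
      rewrite S_INR; lra. }
    assert (HML2 : 0 <= M * L * a ^ 2)
      by (apply Rmult_le_pos; [apply Rmult_le_pos; lra|apply pow_le; lra]).
    assert (Eb : beta ^ 2 * INR (S n0) / 4096 = 2 * (INR (S n0) / (8192 * a ^ 2)))
      by (rewrite Hab; field; lra).
    rewrite Eb.
    enough (2 * INR (S G0 * t) * ln (3 * INR (S n0))
            <= INR (S n0) / (8192 * a ^ 2) + 15232 * (M * L * a ^ 2)) by lra.
    destruct (Nat.eq_0_gt_0_cases m) as [Hm|Hm].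
    (* For [m = 0] the training sequences are empty, so the product [S G0 * t] vanishes;
       [description_budget] itself requires [1 <= M]. *)
    + assert (E0 : M = 0) by (unfold M; rewrite Hm; reflexivity).
      rewrite E0 in HT |- *.
      replace (INR (S G0 * t)) with 0 by lra; lra.
    + assert (HM1 : 1 <= M) by (apply (le_INR 1); lia).
      apply description_budget; auto; try lra.
      apply ln_le_log_plus, Rmult_lt_0_compat; lra.
  - set (e1 := ln (1 / eta1)); set (e2 := ln (1 / eta2)).
    assert (H1 : 1/2 < e1) by (apply half_lt_ln_inv; auto).
    assert (H2 : 1/2 < e2) by (apply half_lt_ln_inv; auto).
    assert (H3 : ln (1 / (beta * delta)) = ln a + lam).
    { unfold lam; rewrite <- ln_mult; [f_equal; unfold a; field; lra|lra|].
      apply Rdiv_lt_0_compat; lra. }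
    assert (H4 : 1/2 < ln a).
    { replace a with (1 / beta) by (unfold a; field; lra); apply half_lt_ln_inv; auto. }
    rewrite H3.
    assert (Hp2 : 1 <= a ^ 2) by nra.
    assert (Hp4 : 1 <= a ^ 4) by nra.
    assert (E6 : a ^ 6 = a ^ 4 * a ^ 2) by ring.
    assert (Hp6 : a ^ 4 <= a ^ 6) by (rewrite E6; nra).
    assert (Hp62 : a ^ 2 <= a ^ 6) by (rewrite E6; nra).
    replace (M / beta ^ 6) with (M * a ^ 6) by (unfold a; field; lra).
    replace (1 / beta ^ 6) with (a ^ 6) by (unfold a; field; lra).
    replace (1 / beta ^ 4) with (a ^ 4) by (unfold a; field; lra).
    (* The factor 2 pays for [ln (1 / eta1)], known only to exceed [1/2]. The dominant constant is
       then [2 * 8192 * 15232], about 250 million. *)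
    assert (HP1 : M * L * a ^ 4 <= 2 * (M * a ^ 6 * L ^ 2 * e1)).
    { replace (2 * (M * a ^ 6 * L ^ 2 * e1)) with (M * L * (a ^ 6 * (L * (2 * e1)))) by ring.
      apply Rmult_le_compat_l; [apply Rmult_le_pos; lra|].
      assert (1 <= L * (2 * e1)) by nra. nra. }
    assert (HP2 : a ^ 2 * lam <= 2 * (a ^ 6 * e1 * (ln a + lam))).
    { replace (2 * (a ^ 6 * e1 * (ln a + lam))) with (a ^ 6 * (2 * e1 * (ln a + lam))) by ring.
      apply Rmult_le_compat; try lra; nra. }
    assert (HP3 : 1 <= 2 * (a ^ 6 * e1 * (ln a + lam))).
    { replace (2 * (a ^ 6 * e1 * (ln a + lam))) with (a ^ 6 * (2 * e1 * (ln a + lam))) by ring.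
      replace 1 with (1 * 1) at 1 by ring.
      apply Rmult_le_compat; try lra; nra. }
    assert (HP4 : 0 <= a ^ 4 * e2) by (apply Rmult_le_pos; lra).
    rewrite S_INR; unfold w in Hn0; lra.
Qed.

Lemma risk_ext {X : Type} (mu : dist X) (loss loss' : R -> R -> R) (f g : X -> R) :
  (forall y x, y = 1 \/ y = -1 -> loss y (f x) = loss' y (g x)) ->
  risk mu loss f = risk mu loss' g.
Proof. intros H; apply Series_ext; intros i; rewrite !H; auto. Qed.

Lemma risk_scal {X : Type} (mu : dist X) (loss : R -> R -> R) (k : R) (f : X -> R) :
  risk mu (fun y a => k * loss y a) f = k * risk mu loss f.
Proof. unfold risk; rewrite <- Series_scal_l; apply Series_ext; intros i; ring. Qed.

(** The constant is chosen before the domain, the classes and the loss. Since [m] is a natural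
    number, the statement concerns a finite supremum; for an infinite one the bound would be
    infinite. *)
Theorem theorem7p2 :
  exists C : R, 0 < C /\
  forall (X : Type) (S : (X -> option R) -> Prop) (B : (X -> R) -> Prop)
    (loss : R -> R -> R) (kappa beta eta1 eta2 delta : R) (m : nat),
    inhabited X ->
    (forall s, S s -> forall x v, s x = Some v -> -1 <= v <= 1) ->
    (forall b, B b -> forall x, -1 <= b x <= 1) ->
    (forall y, (y = 1 \/ y = -1) ->
       forall a c t, -1 <= a <= 1 -> -1 <= c <= 1 -> 0 <= t <= 1 ->
         loss y (t * a + (1 - t) * c) <= t * loss y a + (1 - t) * loss y c) ->
    (forall y, (y = 1 \/ y = -1) ->
       forall a c, -1 <= a <= 1 -> -1 <= c <= 1 ->
         Rabs (loss y a - loss y c) <= kappa * Rabs (a - c)) ->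
    0 < beta < 1/2 -> 0 < eta1 < 1/2 -> 0 < eta2 < 1/2 -> 0 < delta < 1/2 ->
    is_supVC S B eta1 eta2 m ->
    numCompR_le S B loss (kappa * (beta + 2 * eta1 + 4 * eta2)) delta
      (C * ( INR m / beta ^ 6 * (log_plus (INR m / beta)) ^ 2 * ln (1 / eta1)
           + 1 / beta ^ 6 * ln (1 / eta1) * ln (1 / (beta * delta))
           + 1 / beta ^ 4 * ln (1 / eta2))).
Proof.
  exists 300000000; split; [lra|].
  intros X S B loss kappa beta eta1 eta2 delta m HX HS HB Hcv Hlip
    Hbeta He1 He2 Hdelta [HVC _].
  destruct (sample_size m beta eta1 eta2 delta Hbeta He1 He2 Hdelta)
    as [G [t [n [HG [Ht [Hn [Hsize Hbound]]]]]]].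
  exists n; split; [exact Hbound|].
  assert (Hk : 0 <= kappa).
  { pose proof (Hlip 1 (or_introl eq_refl) 1 (-1) ltac:(lra) ltac:(lra)) as H.
    pose proof (Rabs_pos (loss 1 1 - loss 1 (-1))).
    rewrite (Rabs_pos_eq (1 - -1)) in H by lra; lra. }
  (* For [kappa = 0] the rescaled loss is [0], since [/ 0 = 0]. *)
  apply erm_learns with (loss := fun y a => / kappa * loss y a) (beta := beta)
    (eta1 := eta1) (eta2 := eta2) (m := m) (G := G) (t := t); auto.
  - intros y Hy a c w Ha Hc Hw; pose proof (Hcv y Hy a c w Ha Hc Hw) as H.
    assert (0 <= / kappa).
    { destruct Hk as [Hk| <-]; [left; apply Rinv_0_lt_compat, Hk|rewrite Rinv_0; lra]. }
    apply Rle_trans with (/ kappa * (w * loss y a + (1 - w) * loss y c)); [|lra].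
    apply Rmult_le_compat_l; auto.
  - intros y Hy a c Ha Hc; rewrite <- Rmult_minus_distr_l, Rabs_mult.
    destruct Hk as [Hk| <-].
    + pose proof (Rinv_0_lt_compat _ Hk); rewrite (Rabs_pos_eq (/ kappa)) by lra.
      apply Rmult_le_reg_l with kappa; auto.
      rewrite <- Rmult_assoc, Rinv_r, Rmult_1_l by lra; auto.
    + rewrite Rinv_0, Rabs_R0, Rmult_0_l; apply Rabs_pos.
  - intros mu f b Hf Hb H; rewrite !risk_scal in H.
    destruct Hk as [Hk| <-].
    + apply Rmult_le_compat_l with (r := kappa) in H; [|lra].
      rewrite Rmult_plus_distr_l, <- !Rmult_assoc, Rinv_r, !Rmult_1_l in H by lra; exact H.
    + rewrite (risk_ext mu loss loss f b); [lra|].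
      intros y x Hy; pose proof (Hlip y Hy (f x) (b x) (Hf x) (Hb x)) as HL.
      rewrite Rmult_0_l in HL; apply Rabs_le_between in HL; lra.
Qed.
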